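(* Let $\beta>0$ and $c_0>0$ be fixed. There exist positive constants $C,c,N_0$, depending only on $\beta$ and $c_0$, such that the following holds. Let $n\ge1$ be an integer and let $a,b>0$ satisfy $a+b\ge c_0$ and $N:=a+b+\beta(n-1)\ge N_0$. Let $\mu_1\le\cdots\le\mu_n$ be drawn from the $\beta$-Jacobi ensemble with parameters $a,b$, and let $$M_1^{\mathrm J}:=\frac1n\sum_{i=1}^n\mu_i,\qquad M_2^{\mathrm J}:=\frac1n\sum_{i=1}^n\big(\mu_i-\mathbb E M_1^{\mathrm J}\big)^2.$$ Then for any $\epsilon>0$, $$\Pr\big(|M_1^{\mathrm J}-\mathbb E M_1^{\mathrm J}|>\epsilon\big)\le C e^{-cNn\epsilon^2},\qquad \Pr\big(|M_2^{\mathrm J}-\mathbb E M_2^{\mathrm J}|>\epsilon\big)\le C e^{-cN\epsilon\min\{N\epsilon,\,n\}}.$$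
   Context: The $\beta$-Jacobi ensemble with parameters $a,b>0$ is the probability distribution of $n$ random variables with joint density $$f_{\mathrm{Jac}}(\mu_1,\ldots,\mu_n)\propto\prod_{1\le i<j\le n}|\mu_i-\mu_j|^\beta\prod_{i=1}^n(1-\mu_i)^{a-1}(1+\mu_i)^{b-1},\qquad -1\le\mu_i\le1,$$ with the variables listed in nondecreasing order. Here $\beta$ is a fixed positive constant, $a+b$ is bounded below by a positive constant, and the regime of interest is $N\to\infty$ (so $a+b\to\infty$ or $n\to\infty$ or both). *)

(* Defs.v *)
From HB Require Import structures.
From mathcomp Require Import all_boot all_order all_algebra.
From mathcomp Require Import all_classical all_reals all_analysis.

Set Implicit Arguments.
Unset Strict Implicit.
Unset Printing Implicit Defensive.

Import Order.TTheory GRing.Theory Num.Theory.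
Import numFieldNormedType.Exports.

Local Open Scope classical_set_scope.
Local Open Scope ring_scope.

Section tuple_product_measure.
Context d (T : measurableType d) (R : realType).
Variables (m : {sigma_finite_measure set T -> \bar R}) (n : nat).
Variable mn : {sigma_finite_measure set (n.-tuple T) -> \bar R}.

Definition cons_pair (p : T * n.-tuple T) : n.+1.-tuple T :=
  [tuple of p.1 :: p.2].

Definition uncons_pair (t : n.+1.-tuple T) : T * n.-tuple T :=
  (thead t, [tuple of behead t]).

Lemma cons_pairK : cancel cons_pair uncons_pair.
Proof.
move=> [x t]; rewrite /uncons_pair /cons_pair /=; congr pair => //.
exact/val_inj.
Qed.

Lemma uncons_pairK : cancel uncons_pair cons_pair.
Proof. by move=> t; rewrite /cons_pair /= [RHS]tuple_eta; apply/val_inj. Qed.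

Lemma measurable_cons_pair : measurable_fun [set: T * n.-tuple T] cons_pair.
Proof. exact: measurable_cons. Qed.

Lemma measurable_uncons_pair : measurable_fun [set: n.+1.-tuple T] uncons_pair.
Proof.
apply/measurable_fun_pairP; split; first exact: measurable_tnth.
exact: measurable_behead.
Qed.

Definition tuple_product_measure : set (n.+1.-tuple T) -> \bar R :=
  pushforward (m \x mn)%E cons_pair.

Let tuple_product_measure0 : tuple_product_measure set0 = 0%E.
Proof. by rewrite /tuple_product_measure /pushforward preimage_set0 measure0. Qed.

Let tuple_product_measure_ge0 A : (0 <= tuple_product_measure A)%E.
Proof.
by rewrite /tuple_product_measure /pushforward; apply: (measure_ge0 (m \x mn)%E).
Qed.

Let tuple_product_measure_sigma_additive :
  semi_sigma_additive tuple_product_measure.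
Proof.
move=> F mF tF mUF; rewrite /tuple_product_measure /pushforward.
rewrite preimage_bigcup; apply: measure_semi_sigma_additive.
- by move=> k; rewrite -[X in measurable X]setTI; exact: measurable_cons_pair.
- apply/trivIsetP => /= i j _ _ ij; rewrite -preimage_setI.
  by move/trivIsetP : tF => /(_ _ _ _ _ ij) ->//; rewrite preimage_set0.
- rewrite -preimage_bigcup -[X in measurable X]setTI.
  exact: measurable_cons_pair.
Qed.

HB.instance Definition _ := isMeasure.Build _ _ _ tuple_product_measure
  tuple_product_measure0 tuple_product_measure_ge0
  tuple_product_measure_sigma_additive.

Let tuple_product_measure_sigma_finite :
  sigma_finite [set: n.+1.-tuple T] tuple_product_measure.
Proof.
have /sigma_finiteP[F [FT ndF Foo]] := sigma_finiteT m.
have /sigma_finiteP[G [GT ndG Goo]] := sigma_finiteT mn.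
exists (fun k => uncons_pair @^-1` (F k `*` G k)).
  rewrite -preimage_bigcup -[LHS](preimage_setT uncons_pair); congr preimage.
  apply/esym/seteqP; split => // -[x t] _.
  have [i _ Fix] : (\bigcup_i F i) x by rewrite -FT.
  have [j _ Gjt] : (\bigcup_i G i) t by rewrite -GT.
  exists (maxn i j) => //; split.
  - by move: (x) Fix; exact/subsetPset/ndF/leq_maxl.
  - by move: (t) Gjt; exact/subsetPset/ndG/leq_maxr.
move=> k; have [mF Fkoo] := Foo k; have [mG Gkoo] := Goo k; split.
  rewrite -[X in measurable X]setTI; apply: measurable_uncons_pair => //.
  exact: measurableX.
rewrite /tuple_product_measure /pushforward -comp_preimage.
rewrite (_ : uncons_pair \o cons_pair = id); last exact/funext/cons_pairK.
by rewrite preimage_id product_measure1E// lte_mul_pinfty// ge0_fin_numE.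
Qed.

HB.instance Definition _ := Measure_isSigmaFinite.Build _ _ _
  tuple_product_measure tuple_product_measure_sigma_finite.

End tuple_product_measure.


(* Lebesgue measure on R^n, with R^n represented by [n.-tuple R] equipped with
   its product (Borel) sigma-algebra. *)
Fixpoint tuple_lebesgue_measure (R : realType) (n : nat) :
    {sigma_finite_measure set (n.-tuple (measurableTypeR R)) -> \bar R} :=
  match n with
  | 0 => \d_[tuple]
  | n'.+1 => tuple_product_measure lebesgue_measure (tuple_lebesgue_measure R n')
  end.

Lemma tuple_lebesgue_measure_box (R : realType) (n : nat)
    (A : 'I_n -> set (measurableTypeR R)) :
  (forall i, measurable (A i)) ->
  tuple_lebesgue_measure R n [set x | forall i, A i (tnth x i)] =
  (\prod_(i < n) lebesgue_measure (A i))%E.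
Proof.
elim: n A => [|n IHn] A mA.
  by rewrite big_ord0 /= diracE mem_set// => -[].
rewrite big_ord_recl -IHn//= /tuple_product_measure /pushforward.
rewrite -product_measure1E//; last first.
  rewrite (_ : mkset _ =
    \big[setI/setT]_(i < n) ((@tnth n _ ^~ i) @^-1` A (lift ord0 i))).
    apply: bigsetI_measurable => i _.
    by rewrite -[X in measurable X]setTI; exact: measurable_tnth.
  rewrite -bigcap_seq; apply/seteqP; split=> x /= Ax i.
    by move=> _; exact: Ax.
  by apply: Ax; rewrite /= mem_index_enum.
congr (_ _); apply/seteqP; split=> -[x t] /= Axt.
  split; first by have := Axt ord0.
  by move=> i; have := Axt (lift ord0 i); rewrite tnthS.
by move=> i; have [Ax At] := Axt; case: (unliftP ord0 i) => [j ->|->]//;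
  rewrite tnthS.
Qed.

(* The density is carried by the configurations listed in nondecreasing order.
   For a < 1 (resp. b < 1), [powR] gives the value 0 rather than +oo at the
   endpoint 1 (resp. -1), which only changes the weight on a null set. *)
Definition jacobi_weight (R : realType) (beta a b : R) (n : nat)
    (x : n.-tuple R) : R :=
  if sorted <=%R x && all (fun y => -1 <= y <= 1) x then
    (\prod_(i < n) \prod_(j < n | (i < j)%N)
       `|tnth x i - tnth x j| `^ beta) *
    \prod_(i < n) ((1 - tnth x i) `^ (a - 1) * (1 + tnth x i) `^ (b - 1))
  else 0.

(* The constant k is the normalizing constant: it is determined by the fact
   that [distribution P X] has total mass 1. *)
Definition jacobi_ensemble (R : realType) (beta a b : R) (n : nat)
    (d : measure_display) (T : measurableType d) (P : probability T R)
    (X : {RV P >-> n.-tuple (measurableTypeR R)}) : Prop :=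
  exists2 k : R, 0 < k &
    forall A : set (n.-tuple (measurableTypeR R)), measurable A ->
      distribution P X A =
      (k%:E * \int[tuple_lebesgue_measure R n]_(x in A)
                (jacobi_weight beta a b x)%:E)%E.

Section empirical_moments.
Context (R : realType) (n : nat) (d : measure_display) (T : measurableType d).
Variables (P : probability T R) (X : {RV P >-> n.-tuple (measurableTypeR R)}).

Definition empirical_mean (w : T) : R :=
  n%:R^-1 * \sum_(i < n) tnth (X w) i.

(* The deviations are taken from the deterministic centre E[empirical_mean],
   not from the random empirical mean. *)
Definition empirical_variance (w : T) : R :=
  n%:R^-1 * \sum_(i < n) (tnth (X w) i - fine 'E_P[empirical_mean]) ^+ 2.

End empirical_moments.

(* Main.v *)
(** Proof idea.  The image of the Jacobi density under the coordinatewise map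
    [x_i |-> x_i + h (1 - x_i^2) p(x_i)], [p] affine, is explicit, and
    differentiating this change of variables at [h = 0] gives an
    integration-by-parts formula without boundary terms, whatever the
    singularities of the density.  Write [m = (b - a) / N], [S = sum (x_i - m)],
    [W = sum (x_i - m)^2].  The field with [p = 1] gives
    [N E(S f) = E(sum (1 - x_i^2) d_i f)], i.e. [S] is an eigenfunction of the
    Jacobi generator, and the field with [p = x - m] shows that the generator maps
    [W] to [c - K W - g S - beta S^2] with [K = 2 N + 2 - beta].  Taking [f = 1]
    yields [E S = 0], and [f = exp (t S)] bounds the logarithmic derivative of the
    moment generating function of [S] by [t n / N], hence the first tail.  Taking
    [f = exp (t W)] and [f = S exp (t W)], and using
    [sum (1 - x_i^2) (x_i - m)^2 <= W] (self-bounding), the logarithmic derivative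
    of the moment generating function of [+-(W - E W)] at [t] is at most of order
    [n / N^2 + t n^2 / N^2] for [0 <= t <= const N]; integrating and optimizing in
    [t] gives the second tail. *)
Require Import Defs.
From HB Require Import structures.
From mathcomp Require Import all_boot all_order all_algebra.
From mathcomp Require Import all_classical all_reals all_analysis.
From mathcomp Require Import measurable_realfun.
From mathcomp Require Import ring lra.

Set Implicit Arguments.
Unset Strict Implicit.
Unset Printing Implicit Defensive.

Import Order.TTheory GRing.Theory Num.Theory.
Import numFieldNormedType.Exports.

Local Open Scope classical_set_scope.
Local Open Scope ring_scope.

(** * Integration against densities *)

(** The density cannot be differentiated directly: it is unbounded near an endpoint when [a < 1] or
    [b < 1], and for [beta < 1] the factors [|x_i - x_j|^beta] have unbounded derivatives where
    points meet. Only the ratio of the transported weight to the original one is differentiated. The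
    field vanishes at 1 and -1 and acts identically on all coordinates, so each singular factor is
    merely multiplied by [1 + h] times a polynomial; the ratio is bounded on the cube and expands
    uniformly there. Affine [p] already suffices, because the divergence is then a polynomial in the
    first two power sums, and the choice of [m] removes the constant left by [p = 1].

    In the second tail the term of order [n / N^2] comes from [beta S^2], which is bounded but not
    centred. It survives at [t = 0]; as [t] is at most of order [N], it adds only a bounded multiple
    of [n / N] to the exponent and ends up in [C]. The two signs differ: for the upper tail part of
    the self-bounding term is absorbed on the left, which is what restricts [t] to [const N]; for
    the lower tail the correlation of [W] and [exp (t W)] has a favourable sign. *)

Section density.
Context d (T : measurableType d) (R : realType).
Variables (mu nu : {measure set T -> \bar R}) (g : T -> R).
Hypothesis g0 : forall x, 0 <= g x.
Hypothesis mg : measurable_fun setT g.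
Hypothesis nuE : forall A, measurable A ->
  nu A = (\int[mu]_(x in A) (g x)%:E)%E.

Import HBNNSimple.
Local Open Scope ereal_scope.

(** Both sides are monotone limits along the same simple functions, which reduces the claim to
    indicators, where it is [nuE]. *)
Lemma ge0_integral_density (f : T -> \bar R) (E : set T) :
  measurable E -> measurable_fun E f -> (forall x, E x -> 0 <= f x) ->
  \int[nu]_(x in E) f x = \int[mu]_(x in E) (f x * (g x)%:E).
Proof.
move=> mE mf f0.
have mgE : measurable_fun E (EFin \o g).
  by apply/measurable_EFinP; exact: measurable_funTS.
pose h := nnsfun_approx mE mf.
have -> : \int[nu]_(x in E) f x =
    lim (\int[nu]_(x in E) (EFin \o h n) x @[n --> \oo]).
  have fE x : E x -> f x = lim ((EFin \o h n) x @[n --> \oo]).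
    by move=> Ex; apply/esym/cvg_lim => //; exact: cvg_nnsfun_approx.
  under eq_integral => x /[!inE] /fE -> //.
  apply: monotone_convergence => //.
  - move=> n; apply/measurable_EFinP.
    by apply: (measurable_funS measurableT) => //; exact/measurable_funP.
  - by move=> n x Ex //=; rewrite lee_fin.
  - by move=> x Ex a b ab; rewrite lee_fin; exact/lefP/nd_nnsfun_approx.
have -> : \int[mu]_(x in E) (f x * (g x)%:E) =
    lim (\int[mu]_(x in E) ((EFin \o h n) \* (EFin \o g)) x @[n --> \oo]).
  have fg x : E x ->
      f x * (g x)%:E = lim (((EFin \o h n) \* (EFin \o g)) x @[n --> \oo]).
    by move=> Ex; apply/esym/cvg_lim => //; apply: cvgeZr;
      [exact: fin_numE|exact: cvg_nnsfun_approx].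
  under eq_integral => x /[!inE] /fg -> //.
  apply: monotone_convergence => [//| | |].
  - move=> n; apply/emeasurable_funM => //; apply/measurable_funTS.
    exact/measurable_EFinP.
  - by move=> n x Ex /=; rewrite mule_ge0 ?lee_fin.
  - move=> x Ex a b ab/=; rewrite lee_wpmul2r ?lee_fin//.
    exact/lefP/nd_nnsfun_approx.
congr (lim _); apply: congr2 => //; apply: funext => n /=.
have indich r : measurable_fun E (fun x => (r * \1_(h n @^-1` [set r]) x)%:E).
  by apply: (measurable_comp measurableT) => //; exact: measurable_funM.
transitivity (\int[nu]_(x in E)
   (\sum_(y \in range (h n)) (y * \1_(h n @^-1` [set y]) x)%:E)).
  by apply: eq_integral => t tE; rewrite /= fimfunE -fsumEFin.
rewrite ge0_integral_fsum//; last by move=> r x Ex; exact: nnfun_muleindic_ge0.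
transitivity (\int[mu]_(x in E) (\sum_(y \in range (h n))
    (y * \1_(h n @^-1` [set y]) x)%:E * (g x)%:E)); last first.
  apply: eq_integral => x xE.
  rewrite -ge0_mule_fsuml => [|y]; last exact: nnfun_muleindic_ge0.
  by rewrite fsumEFin // -(fimfunE _ x).
rewrite ge0_integral_fsum//; last 2 first.
  - by move=> y; apply: emeasurable_funM.
  - move=> y x Ex; apply: mule_ge0; first exact: nnfun_muleindic_ge0.
    by rewrite lee_fin.
apply: eq_fsbigr => r rhn.
under eq_integral do rewrite EFinM.
rewrite integralZl_indic_nnsfun => //.
under [RHS]eq_integral do rewrite EFinM -muleA.
rewrite [RHS]ge0_integralZl//.
- congr (_ * _); transitivity (\int[mu]_(x in E)
      ((EFin \o g) \_ (h n @^-1` [set r])) x); last first.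
    by apply: eq_integral => x xE; rewrite epatch_indic muleC.
  rewrite -integral_mkcondr -nuE; last exact: measurableI.
  rewrite integral_indic//.
  by rewrite setIC.
- by apply: emeasurable_funM => //; exact/measurable_EFinP.
- by move=> t Et; rewrite mule_ge0 ?lee_fin.
- by move: rhn; rewrite inE => -[t _ <-]; rewrite lee_fin.
Qed.

End density.

(** * Change of variables *)

Section change_of_variable.
Context (R : realType) (tau rho : R -> R).
Hypothesis tau_mono : {homo tau : x y / x < y}.
Hypothesis tau_surj : forall y, exists x, tau x = y.
Hypothesis mtau : measurable_fun setT tau.
Hypothesis mrho : measurable_fun setT rho.
Hypothesis rho0 : forall x, 0 <= rho x.
Hypothesis rhoE : forall e f, e < f ->
  (\int[lebesgue_measure]_(x in `]e, f]) (rho x)%:E = (tau f - tau e)%:E)%E.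

(** The image under [tau] of the measure with density [rho] gives each half-open interval its
    length, so it is Lebesgue measure by uniqueness. Only the increments of [tau] enter, so kinks
    are allowed. *)
Lemma ge0_integral_change_of_variable (f : R -> \bar R) :
  measurable_fun setT f -> (forall x, 0 <= f x)%E ->
  (\int[lebesgue_measure]_x f x =
   \int[lebesgue_measure]_x (f (tau x) * (rho x)%:E))%E.
Proof.
move=> mf f0.
have tau_le : {mono tau : x y / x <= y} := le_mono tau_mono.
pose mtau_mixin := isMeasurableFun.Build _ _ (measurableTypeR R)
  (measurableTypeR R) tau mtau.
pose tau_pack : {mfun measurableTypeR R >-> measurableTypeR R} :=
  HB.pack tau mtau_mixin.
pose nu0 (A : set (measurableTypeR R)) :=
  (\int[lebesgue_measure]_(x in A) (rho x)%:E)%E.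
have nu00 : nu0 set0 = 0%E by rewrite /nu0 integral_set0.
have nu0_ge0 A : (0 <= nu0 A)%E by apply: integral_ge0 => x _; rewrite lee_fin.
have nu0_sigma : semi_sigma_additive nu0.
  apply: (@semi_sigma_additive_nng_induced _ _ _ lebesgue_measure (EFin \o rho)).
    exact/measurable_EFinP.
  by move=> x; rewrite lee_fin.
pose nu_mixin := isMeasure.Build _ _ _ nu0 nu00 nu0_ge0 nu0_sigma.
pose nu : {measure set (measurableTypeR R) -> \bar R} := HB.pack nu0 nu_mixin.
have nuE A : measurable A -> lebesgue_measure A = pushforward nu tau_pack A.
  apply: lebesgue_measure_unique => _ [[c d] _ <-] /=.
  have [e eE] := tau_surj c; have [b bE] := tau_surj d; subst c d.
  rewrite /pushforward (_ : _ @^-1` _ = `]e, b]%classic); last first.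
    by apply/seteqP; split => x /=; rewrite !in_itv/= tau_le (leW_mono tau_le).
  rewrite lebesgue_measure_itv/= lte_fin (leW_mono tau_le) /nu0.
  case: ltP => [eb|be]; first by rewrite rhoE// EFinB.
  by rewrite set_itv_ge ?integral_set0// bnd_simp -leNgt.
transitivity (\int[pushforward nu tau_pack]_y f y)%E.
  by apply: eq_measure_integral => A mA _; exact: (nuE A mA).
have f0T : {in setT, forall y, 0 <= f y}%E by move=> y _.
rewrite [LHS](@ge0_integral_pushforward _ _ (measurableTypeR R)
  (measurableTypeR R) R tau mtau nu setT f measurableT mf f0T).
rewrite preimage_setT (@ge0_integral_density _ _ _ lebesgue_measure nu rho)//.
- exact: measurableT_comp.
- by move=> x _; exact: f0.
Qed.

End change_of_variable.

(** * One Euler step along a cubic field that vanishes at the endpoints of [-1, 1] *)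

Section flow.
Context (R : realType) (p0 p1 : R).

Definition vfield (x : R) := (1 - x ^+ 2) * (p0 + p1 * x).

(** The divided difference of [vfield], a polynomial whose diagonal values are the derivative of the
    field. *)
Definition vslope (x y : R) := p1 * (1 - x ^+ 2 - x * y - y ^+ 2) - p0 * (x + y).

Lemma vfieldB x y : vfield x - vfield y = (x - y) * vslope x y.
Proof. by rewrite /vfield /vslope; ring. Qed.

(* Off [-1, 1] the map is the identity, so that it is a bijection of the whole
   line; it is only piecewise smooth. *)
Definition flow (h x : R) := if -1 <= x <= 1 then x + h * vfield x else x.

Definition dflow (h x : R) := if -1 <= x <= 1 then 1 + h * vslope x x else 1.

(** On [-1, 1] one has [|vslope| <= 2 (|p0| + |p1|)]; the constant 4 keeps [|h vslope|] below 1/2,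
    hence every factor [1 + h vslope] at least 1/2. *)
Definition small_time (h : R) := `|h| * (4 * (`|p0| + `|p1|)) <= 1.

Lemma vslope_small h x y : small_time h -> -1 <= x <= 1 -> -1 <= y <= 1 ->
  `|h * vslope x y| <= 2^-1.
Proof.
move=> hh /andP[x1 x2] /andP[y1 y2].
have q : `|vslope x y| <= 2 * (`|p0| + `|p1|).
  rewrite /vslope (le_trans (ler_normB _ _))// !normrM addrC mulrDr.
  rewrite lerD// mulrC ler_wpM2r// ler_norml.
    by apply/andP; split; lra.
  by apply/andP; split; nra.
rewrite normrM (le_trans (ler_wpM2l (normr_ge0 h) q))//.
by move: hh; rewrite /small_time; lra.
Qed.

Lemma flow_increasing_itv h x y : small_time h ->
  -1 <= x <= 1 -> -1 <= y <= 1 -> x < y -> x + h * vfield x < y + h * vfield y.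
Proof.
move=> hh hx hy xy.
have := vslope_small hh hx hy; rewrite ler_norml => /andP[q1 _].
have : (y - x) * (1 + h * vslope x y) > 0 by rewrite mulr_gt0//; lra.
have := vfieldB x y; nra.
Qed.

Lemma vfield1 : vfield 1 = 0. Proof. by rewrite /vfield; ring. Qed.

Lemma vfieldN1 : vfield (-1) = 0. Proof. by rewrite /vfield; ring. Qed.

(** Monotonicity together with the fixed endpoints traps the image. *)
Lemma flow_itv h x : small_time h -> -1 <= x <= 1 -> -1 <= x + h * vfield x <= 1.
Proof.
move=> hh hx; case/andP: (hx); rewrite le_eqVlt => /predU1P[<-|x1].
  by rewrite vfieldN1 mulr0 addr0 => ?; apply/andP; split; lra.
rewrite le_eqVlt => /predU1P[->|x2].
  by rewrite vfield1 mulr0 addr0; apply/andP; split; lra.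
have I1 : -1 <= (1 : R) <= 1 by apply/andP; split; lra.
have IN1 : -1 <= (-1 : R) <= 1 by apply/andP; split; lra.
have := flow_increasing_itv hh IN1 hx x1.
have := flow_increasing_itv hh hx I1 x2.
by rewrite vfieldN1 vfield1 mulr0 !addr0 => ? ?; apply/andP; split; lra.
Qed.

Lemma flow_increasing h : small_time h -> {homo flow h : x y / x < y}.
Proof.
move=> hh x y xy; rewrite /flow; case: ifPn => hx; case: ifPn => hy //.
- exact: flow_increasing_itv.
- have /andP[_ ?] := flow_itv hh hx; case/andP : hx => x1 x2.
  by move: hy; rewrite negb_and -!ltNge => /orP[]; lra.
- have /andP[? _] := flow_itv hh hy; case/andP : hy => x1 x2.
  by move: hx; rewrite negb_and -!ltNge => /orP[]; lra.
Qed.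

Lemma is_derive_flow h (x : R) :
  is_derive x 1 (fun x => x + h * vfield x) (1 + h * vslope x x).
Proof.
rewrite /vfield; apply: is_derive_eq.
by rewrite /GRing.scale/= /vslope; ring.
Qed.

Lemma continuous_flow_itv h : continuous (fun x => x + h * vfield x).
Proof.
move=> x; apply: differentiable_continuous.
by apply/derivable1_diffP; have [] := is_derive_flow h x.
Qed.

Lemma continuous_dflow_itv h : continuous (fun x => 1 + h * vslope x x).
Proof.
move=> x.
have D : is_derive x 1 (fun x => 1 + h * vslope x x)
    (h * (p1 * (- (6 * x)) - 2 * p0)).
  by rewrite /vslope; apply: is_derive_eq; rewrite /GRing.scale/=; ring.
by apply: differentiable_continuous; apply/derivable1_diffP; case: D.
Qed.

Lemma flow_surj h : small_time h -> forall y, exists x, flow h x = y.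
Proof.
move=> hh y; have [hy|/negPf hy] := boolP (-1 <= y <= 1); last first.
  by exists y; rewrite /flow hy.
have [|||x] := @IVT R (fun x => x + h * vfield x) (-1) 1 y.
- lra.
- exact/continuous_subspaceT/continuous_flow_itv.
- by rewrite vfield1 vfieldN1 mulr0 !addr0 min_l ?max_r//; lra.
by rewrite in_itv/= => hx <-; exists x; rewrite /flow hx.
Qed.

Lemma measurable_itvN11 : measurable_fun [set: R] (fun x : R => -1 <= x <= 1).
Proof.
apply: measurable_and; exact: measurable_fun_ler.
Qed.

Lemma measurable_flow h : measurable_fun [set: R] (flow h).
Proof.
apply: measurable_fun_ifT => //; first exact: measurable_itvN11.
by apply: continuous_measurable_fun; exact: continuous_flow_itv.
Qed.

Lemma measurable_dflow h : measurable_fun [set: R] (dflow h).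
Proof.
apply: measurable_fun_ifT => //; first exact: measurable_itvN11.
by apply: continuous_measurable_fun; exact: continuous_dflow_itv.
Qed.

Lemma dflow_ge0 h : small_time h -> forall x, 0 <= dflow h x.
Proof.
move=> hh x; rewrite /dflow; case: ifPn => hx //.
have := vslope_small hh hx hx; rewrite ler_norml => /andP[]; lra.
Qed.

Let integral_dflow_split h e g f : small_time h -> e < g -> g < f ->
  (\int[lebesgue_measure]_(x in `]e, g]) (dflow h x)%:E =
    (flow h g - flow h e)%:E)%E ->
  (\int[lebesgue_measure]_(x in `]g, f]) (dflow h x)%:E =
    (flow h f - flow h g)%:E)%E ->
  (\int[lebesgue_measure]_(x in `]e, f]) (dflow h x)%:E =
    (flow h f - flow h e)%:E)%E.
Proof.
move=> hh eg gf E1 E2.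
rewrite (@itv_bndbnd_setU _ _ _ (BRight g))//; last 2 first.
- by rewrite bnd_simp ltW.
- by rewrite bnd_simp ltW.
rewrite ge0_integral_setU//=; last 3 first.
- by apply/measurable_EFinP; apply: measurable_funTS; exact: measurable_dflow.
- by move=> x _; rewrite lee_fin dflow_ge0.
- by apply: lt_disjoint => x y; rewrite !in_itv/= => /andP[_ xg] /andP[gy _];
    exact: le_lt_trans xg gy.
by rewrite E1 E2 -EFinD; congr EFin; lra.
Qed.

Let integral_cst1 (e f : R) : e < f ->
  (\int[lebesgue_measure]_(x in `]e, f]) 1%:E = (f - e)%:E)%E.
Proof.
move=> ef; rewrite integral_cst//= mul1e lebesgue_measure_itv/= lte_fin ef.
by rewrite EFinB.
Qed.

(** The interval is cut at -1 and 1: the fundamental theorem of calculus applies inside, the map is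
    the identity outside, and the pieces match because the endpoints are fixed. *)
Lemma integral_dflow h e f : small_time h -> e < f ->
  (\int[lebesgue_measure]_(x in `]e, f]) (dflow h x)%:E =
    (flow h f - flow h e)%:E)%E.
Proof.
move=> hh.
have mdE (A : set (measurableTypeR R)) :
      measurable_fun A (fun x => (dflow h x)%:E).
  by apply/measurable_EFinP; apply: measurable_funTS; exact: measurable_dflow.
have FN1 : flow h (-1) = -1.
  by rewrite /flow vfieldN1 mulr0 addr0; case: ifP.
have F1 : flow h 1 = 1 by rewrite /flow vfield1 mulr0 addr0; case: ifP.
have left a b : a < b -> b <= -1 ->
    (\int[lebesgue_measure]_(x in `]a, b]) (dflow h x)%:E =
      (flow h b - flow h a)%:E)%E.
  move=> ab b1; have -> : flow h b = b.
    by move: b1; rewrite le_eqVlt => /predU1P[->//|b1]; rewrite /flow leNgt b1.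
  have -> : flow h a = a by rewrite /flow leNgt (lt_le_trans ab b1).
  (* When [b] is -1, [dflow] already takes its inner branch at [b]; passing to the open interval
     discards this single point. *)
  rewrite -integral_cst1// integral_itv_bndoo; last first.
    exact: measurable_cst.
  rewrite [LHS]integral_itv_bndoo; last exact: mdE.
  apply: eq_integral => x; rewrite inE/= in_itv/= => /andP[_ xb].
  by rewrite /dflow leNgt (lt_le_trans xb b1).
have right a b : a < b -> 1 <= a ->
    (\int[lebesgue_measure]_(x in `]a, b]) (dflow h x)%:E =
      (flow h b - flow h a)%:E)%E.
  move=> ab a1; have -> : flow h a = a.
    move: a1; rewrite le_eqVlt => /predU1P[<-//|a1].
    by rewrite /flow [a <= _]leNgt a1 andbF.
  have -> : flow h b = b.
    by rewrite /flow [b <= _]leNgt (le_lt_trans a1 ab) andbF.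
  rewrite -integral_cst1//.
  apply: eq_integral => x; rewrite inE/= in_itv/= => /andP[xa _].
  by rewrite /dflow [x <= _]leNgt (le_lt_trans a1 xa) andbF.
have mid a b : a < b -> -1 <= a -> b <= 1 ->
    (\int[lebesgue_measure]_(x in `]a, b]) (dflow h x)%:E =
      (flow h b - flow h a)%:E)%E.
  move=> ab a1 b1.
  have Fa : flow h a = a + h * vfield a by rewrite /flow a1 (le_trans (ltW ab)).
  have Fb : flow h b = b + h * vfield b by rewrite /flow b1 andbT (le_trans a1 (ltW ab)).
  rewrite Fa Fb integral_itv_obnd_cbnd; last exact: mdE.
  rewrite EFinB.
  rewrite -(@continuous_FTC2 R (fun x => 1 + h * vslope x x) (fun x => x + h * vfield x))//.
  - apply: eq_integral => x; rewrite inE/= in_itv/= => /andP[ax xb].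
    by rewrite /dflow (le_trans a1 ax) (le_trans xb b1).
  - exact/continuous_subspaceT/continuous_dflow_itv.
  - split.
    + by move=> x _; have [] := is_derive_flow h x.
    + by apply: cvg_at_right_filter; exact: continuous_flow_itv.
    + by apply: cvg_at_left_filter; exact: continuous_flow_itv.
  - by move=> x _; rewrite derive1E; have [] := is_derive_flow h x.
have right' a b : a < b -> -1 <= a ->
    (\int[lebesgue_measure]_(x in `]a, b]) (dflow h x)%:E =
      (flow h b - flow h a)%:E)%E.
  move=> ab a1; have [b1|b1] := leP b 1; first exact: mid.
  have [a1'|a1'] := leP 1 a; first exact: right.
  apply: (integral_dflow_split hh a1' b1); first exact: mid.
  exact: right.
move=> ef; have [f1|f1] := leP f (-1); first exact: left.
have [e1|e1] := leP (-1) e; first exact: right'.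
by apply: (integral_dflow_split hh e1 f1); [exact: left|exact: right'].
Qed.

Lemma ge0_integral_flow h (f : R -> \bar R) : small_time h ->
  measurable_fun setT f -> (forall x, 0 <= f x)%E ->
  (\int[lebesgue_measure]_x f x =
   \int[lebesgue_measure]_x (f (flow h x) * (dflow h x)%:E))%E.
Proof.
move=> hh mf f0; apply: ge0_integral_change_of_variable => //.
- exact: flow_increasing.
- exact: flow_surj.
- exact: measurable_flow.
- exact: measurable_dflow.
- exact: dflow_ge0.
- by move=> e g; exact: integral_dflow.
Qed.

End flow.

(** * Iterated integrals and coordinatewise substitution on R^n *)

Section tuple_integral.
Context (R : realType).
Local Notation lambda := (@lebesgue_measure R).
Local Notation Rn n := (n.-tuple (measurableTypeR R)).

Lemma ge0_integral_tuple_lebesgueS n (f : Rn n.+1 -> \bar R) :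
  measurable_fun setT f -> (forall x, 0 <= f x)%E ->
  (\int[tuple_lebesgue_measure R n.+1]_x f x =
   \int[lambda]_x \int[tuple_lebesgue_measure R n]_t f [tuple of x :: t])%E.
Proof.
move=> mf f0.
have f0T : {in setT, forall y, 0 <= f y}%E by move=> y _.
have mcons := @measurable_cons_pair _ (measurableTypeR R) n.
have := @ge0_integral_pushforward _ _ _ _ R _ mcons
  (lambda \x tuple_lebesgue_measure R n)%E setT f measurableT mf f0T.
rewrite preimage_setT => ->.
rewrite fubini_tonelli1//; first exact: measurableT_comp.
by move=> x; exact: f0.
Qed.

Lemma measurable_fun_tuple_lebesgue_section n (f : Rn n.+1 -> \bar R) :
  measurable_fun setT f -> (forall x, 0 <= f x)%E ->
  measurable_fun setT
    (fun x : measurableTypeR R =>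
       \int[tuple_lebesgue_measure R n]_t f [tuple of x :: t])%E.
Proof.
move=> mf f0.
have mcons := @measurable_cons_pair _ (measurableTypeR R) n.
apply: (@measurable_fun_fubini_tonelli_F _ _ _ _ R
  (tuple_lebesgue_measure R n) (f \o (@cons_pair _ (measurableTypeR R) n))).
  exact: measurableT_comp.
by move=> x; exact: f0.
Qed.

Lemma measurable_map_tuple n (tau : R -> R) : measurable_fun setT tau ->
  measurable_fun [set: Rn n] (map_tuple tau : Rn n -> Rn n).
Proof.
move=> mtau; apply/measurable_fun_tnthP => i.
rewrite (_ : _ \o _ = tau \o (fun x : Rn n => tnth x i)).
  by apply: measurableT_comp => //; exact: measurable_tnth.
by apply/funext => x /=; rewrite tnth_map.
Qed.

(** Tonelli splits off the head coordinate, where the one-dimensional formula applies; induction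
    treats the tail. *)
Lemma ge0_integral_tuple_change_of_variable (tau rho : R -> R) :
  measurable_fun setT tau -> measurable_fun setT rho ->
  (forall x, 0 <= rho x) ->
  (forall f : R -> \bar R, measurable_fun setT f -> (forall x, 0 <= f x)%E ->
    (\int[lambda]_x f x = \int[lambda]_x (f (tau x) * (rho x)%:E))%E) ->
  forall n (f : Rn n -> \bar R),
  measurable_fun setT f -> (forall x, 0 <= f x)%E ->
  (\int[tuple_lebesgue_measure R n]_x f x =
   \int[tuple_lebesgue_measure R n]_x
     (f (map_tuple tau x) * (\prod_(i < n) rho (tnth x i))%:E))%E.
Proof.
move=> mtau mrho rho0 cov; elim=> [|n IHn] f mf f0.
  apply: eq_integral => x _; rewrite big_ord0 mule1; congr f.
  by rewrite !tuple0; apply/val_inj.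
have mprod k : measurable_fun [set: Rn k] (fun x => (\prod_(i < k) rho (tnth x i))%:E).
  apply/measurable_EFinP; apply: measurable_prod => i _.
  by apply: measurableT_comp => //; exact: measurable_tnth.
have prod0 k (x : Rn k) : (0 <= (\prod_(i < k) rho (tnth x i))%:E)%E.
  by rewrite lee_fin prodr_ge0.
have mmap k := @measurable_map_tuple k tau mtau.
rewrite ge0_integral_tuple_lebesgueS//.
rewrite ge0_integral_tuple_lebesgueS//; last 2 first.
- by apply: emeasurable_funM; [exact: (measurableT_comp mf (mmap _))|exact: mprod].
- move=> x; apply: mule_ge0; first exact: f0.
  exact: prod0.
rewrite cov; last 2 first.
- exact: measurable_fun_tuple_lebesgue_section.
- by move=> x; exact: integral_ge0.
apply: eq_integral => x _.
have mfx : measurable_fun setT (fun t : Rn n => f [tuple of tau x :: t]).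
  apply: measurableT_comp => //.
  by apply: measurable_cons => //; exact: measurable_cst.
rewrite (IHn (fun t => f [tuple of tau x :: t]))//.
rewrite -ge0_integralZr//; last 3 first.
- by apply: emeasurable_funM; [exact: (measurableT_comp mfx (mmap _))|exact: mprod].
- move=> t _; apply: mule_ge0; first exact: f0.
  exact: prod0.
- by rewrite lee_fin.
apply: eq_integral => t _.
rewrite -muleA -EFinM; congr (f _ * _%:E)%E.
  by apply/val_inj.
rewrite big_ord_recl mulrC; congr (_ * _).
by apply: eq_bigr => i _; rewrite tnthS.
Qed.

End tuple_integral.

(** * Invariance of the Jacobi weight *)

Lemma measurable_set_pred d (T : measurableType d) (f : T -> bool) :
  measurable_fun setT f -> measurable [set x | f x].
Proof.
by move=> mf; rewrite -[X in measurable X]setTI; exact: (mf measurableT [set true]).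
Qed.

Section jacobi_change_of_variable.
Context (R : realType) (beta a b : R) (n : nat).
Local Notation Rn := (n.-tuple (measurableTypeR R)).

Definition ordered_cube : set Rn :=
  [set x | sorted <=%R (x : n.-tuple R) && all (fun y => -1 <= y <= 1) x].

Lemma ordered_cube_itv (x : Rn) i : ordered_cube x -> -1 <= tnth x i <= 1.
Proof. by move=> /andP[_ /allP]; apply; exact: mem_tnth. Qed.

Lemma measurable_fun_prod_cond (I : finType) (P : pred I) (F : I -> Rn -> R) :
  (forall i, P i -> measurable_fun setT (F i)) ->
  measurable_fun setT (fun x => \prod_(i | P i) F i x).
Proof.
move=> mF; rewrite (_ : (fun _ => _) =
    (fun x => \prod_i if P i then F i x else 1)); last first.
  by apply/funext => x; rewrite big_mkcond.
by apply: measurable_prod => i _; case: (boolP (P i)) => [/mF|].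
Qed.

Lemma measurable_nth_tuple i : measurable_fun setT (fun x : Rn => nth 0 x i).
Proof.
have [ni|ni] := ltnP i n.
  rewrite (_ : (fun _ => _) = (fun x : Rn => tnth x (Ordinal ni))).
    exact: measurable_tnth.
  by apply/funext => x; rewrite (tnth_nth 0).
rewrite (_ : (fun _ => _) = cst 0); first exact: measurable_cst.
by apply/funext => x /=; rewrite nth_default// size_tuple.
Qed.

(** Order and range are expressed through [nth] at all natural indices, guarded by implications, so
    that the set is a countable intersection of elementary conditions. *)
Lemma measurable_ordered_cube : measurable ordered_cube.
Proof.
have -> : ordered_cube =
    \bigcap_i ([set x : Rn | (i.+1 < n)%N ==> (nth 0 x i <= nth 0 x i.+1)] `&`
               [set x : Rn | (i < n)%N ==> (-1 <= nth 0 x i <= 1)]).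
  apply/seteqP; split => x.
    move=> /andP[/(sortedP 0) sx /(all_nthP 0) ax] i _; split => /=.
      by apply/implyP => ni; apply: sx; rewrite size_tuple.
    by apply/implyP => ni; apply: ax; rewrite size_tuple.
  move=> H; apply/andP; split.
    by apply/(sortedP 0) => i; rewrite size_tuple => ni;
      have [/= /implyP/(_ ni)] := H i I.
  by apply/(all_nthP 0) => i; rewrite size_tuple => ni;
    have [_ /= /implyP/(_ ni)] := H i I.
apply: bigcap_measurableType => i _; apply: measurableI.
  case: (i.+1 < n)%N => /=; last by rewrite (_ : [set _ | _] = setT)//; exact/seteqP.
  apply: measurable_set_pred.
  exact: measurable_fun_ler (measurable_nth_tuple i) (measurable_nth_tuple i.+1).
case: (i < n)%N => /=; last by rewrite (_ : [set _ | _] = setT)//; exact/seteqP.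
apply: measurable_set_pred; apply: measurable_and.
  by apply: measurable_fun_ler => //; exact: measurable_nth_tuple.
by apply: measurable_fun_ler => //; exact: measurable_nth_tuple.
Qed.

Lemma measurable_jacobi_weight :
  measurable_fun setT (@jacobi_weight R beta a b n : Rn -> R).
Proof.
rewrite /jacobi_weight; apply: measurable_fun_ifT => //.
  apply: (measurable_fun_bool true); rewrite setTI.
  exact: measurable_ordered_cube.
apply: measurable_funM.
  apply: measurable_fun_prod_cond => i _; apply: measurable_fun_prod_cond => j _.
  apply: (measurableT_comp (measurable_powR _)); apply: measurableT_comp => //.
  by apply: measurable_funB; exact: measurable_tnth.
apply: measurable_fun_prod_cond => i _; apply: measurable_funM;
  apply: (measurableT_comp (measurable_powR _)).
  by apply: measurable_funB => //; exact: measurable_tnth.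
by apply: measurable_funD => //; exact: measurable_tnth.
Qed.

Lemma jacobi_weight_ge0 (x : Rn) : 0 <= jacobi_weight beta a b x.
Proof.
rewrite /jacobi_weight; case: ifP => // _; apply: mulr_ge0.
  by apply: prodr_ge0 => i _; apply: prodr_ge0 => j _; exact: powR_ge0.
by apply: prodr_ge0 => i _; apply: mulr_ge0; exact: powR_ge0.
Qed.

Lemma jacobi_weight_out (x : Rn) : ~ ordered_cube x -> jacobi_weight beta a b x = 0.
Proof. by move=> /negP/negbTE; rewrite /jacobi_weight => ->. Qed.

Section with_field.
Variables p0 p1 : R.

(* [w (T x) T'(x) / w x] for the Jacobi weight [w] and the flow [T] at time [h]. *)
Definition jacobian (h : R) (x : Rn) : R :=
  (\prod_(i < n) \prod_(j < n | (i < j)%N)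
      (1 + h * vslope p0 p1 (tnth x i) (tnth x j)) `^ beta) *
  \prod_(i < n)
    ((1 - h * ((1 + tnth x i) * (p0 + p1 * tnth x i))) `^ (a - 1) *
     (1 + h * ((1 - tnth x i) * (p0 + p1 * tnth x i))) `^ (b - 1) *
     dflow p0 p1 h (tnth x i)).

Definition tuple_flow (h : R) : Rn -> Rn := map_tuple (flow p0 p1 h).

Lemma measurable_tuple_flow h : measurable_fun setT (tuple_flow h).
Proof. exact: measurable_map_tuple (measurable_flow _ _ _). Qed.

Lemma measurable_jacobian h : measurable_fun setT (jacobian h).
Proof.
have mt i : measurable_fun setT (fun x : Rn => tnth x i).
  exact: measurable_tnth.
have mp i : measurable_fun setT (fun x : Rn => p0 + p1 * tnth x i).
  by apply: measurable_funD => //; apply: measurable_funM => //; exact: mt.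
apply: measurable_funM.
  apply: measurable_fun_prod_cond => i _; apply: measurable_fun_prod_cond => j _.
  apply: (measurableT_comp (measurable_powR _)).
  apply: measurable_funD => //; apply: measurable_funM => //.
  apply: measurable_funB; last by apply: measurable_funM => //; apply: measurable_funD; exact: mt.
  apply: measurable_funM => //.
  apply: measurable_funB; last by apply: measurable_funX; exact: mt.
  apply: measurable_funB; last by apply: measurable_funM; exact: mt.
  by apply: measurable_funB => //; apply: measurable_funX; exact: mt.
apply: measurable_fun_prod_cond => i _; apply: measurable_funM.
  apply: measurable_funM; apply: (measurableT_comp (measurable_powR _)).
    apply: measurable_funB => //; apply: measurable_funM => //.
    by apply: measurable_funM; [apply: measurable_funD => //; exact: mt|exact: mp].
  apply: measurable_funD => //; apply: measurable_funM => //.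
  by apply: measurable_funM; [apply: measurable_funB => //; exact: mt|exact: mp].
by apply: (measurableT_comp (measurable_dflow _ _ _)); exact: mt.
Qed.

Lemma jacobian_ge0 h x : small_time p0 p1 h -> 0 <= jacobian h x.
Proof.
move=> hh; apply: mulr_ge0.
  by apply: prodr_ge0 => i _; apply: prodr_ge0 => j _; exact: powR_ge0.
apply: prodr_ge0 => i _; apply: mulr_ge0; last exact: dflow_ge0.
by apply: mulr_ge0; exact: powR_ge0.
Qed.

Lemma flow_itvE h y : small_time p0 p1 h ->
  (-1 <= flow p0 p1 h y <= 1) = (-1 <= y <= 1).
Proof.
move=> hh; rewrite {1 2}/flow; case: ifPn => [yI|/negbTE->//].
by rewrite flow_itv.
Qed.

Lemma ordered_cube_flow h x : small_time p0 p1 h ->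
  ordered_cube (tuple_flow h x) = ordered_cube x.
Proof.
move=> hh; rewrite /ordered_cube /=; congr (is_true (_ && _)).
  apply: (@mono_sorted R R (flow p0 p1 h) <=%R <=%R).
  exact: (le_mono (flow_increasing hh)).
by rewrite all_map; apply: eq_all => y /=; rewrite flow_itvE.
Qed.

(** With [p = p0 + p1 x], the identities [1 - T x = (1 - x) (1 - h (1 + x) p)],
    [1 + T x = (1 + x) (1 + h (1 - x) p)] and [T x - T y = (x - y) (1 + h vslope x y)] multiply each
    factor of the weight by a positive one. The equality thus also holds at endpoints and coinciding
    points, where no quotient could be formed. *)
Lemma jacobi_weight_flow h x : small_time p0 p1 h ->
  jacobi_weight beta a b (tuple_flow h x) *
    (\prod_(i < n) dflow p0 p1 h (tnth x i)) =
  jacobi_weight beta a b x * jacobian h x.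
Proof.
move=> hh; have [xD|xD] := pselect (ordered_cube x); last first.
  by rewrite !jacobi_weight_out ?mul0r// ordered_cube_flow.
have fxD : ordered_cube (tuple_flow h x) by rewrite ordered_cube_flow.
rewrite /jacobi_weight; move: (xD) (fxD); rewrite /ordered_cube /= => -> ->.
have xI i := ordered_cube_itv i xD.
have fE i : tnth (tuple_flow h x) i = tnth x i + h * vfield p0 p1 (tnth x i).
  by rewrite tnth_map /flow xI.
rewrite /jacobian -[LHS]mulrA [RHS]mulrACA; congr (_ * _).
  rewrite -big_split/=; apply: eq_bigr => i _.
  rewrite -big_split/=; apply: eq_bigr => j _.
  have q := vslope_small hh (xI i) (xI j).
  have q0 : 0 <= 1 + h * vslope p0 p1 (tnth x i) (tnth x j).
    by move: q; rewrite ler_norml => /andP[]; lra.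
  rewrite -powRM//; congr (_ `^ _).
  rewrite !fE -[in RHS](ger0_norm q0) -normrM; congr `|_|.
  have := vfieldB p0 p1 (tnth x i) (tnth x j).
  by move=> /(congr1 (fun z => h * z)); lra.
rewrite -!big_split/=; apply: eq_bigr => i _; rewrite !fE.
have /andP[x1 x2] := xI i.
have small y : `|y| <= 2 -> `|h * (y * (p0 + p1 * tnth x i))| <= 2^-1.
  move=> y2; have q : `|p0 + p1 * tnth x i| <= `|p0| + `|p1|.
    rewrite (le_trans (ler_normD _ _))// lerD2l normrM.
    by rewrite -[leRHS]mulr1 ler_wpM2l// ler_norml x1.
  rewrite !normrM (@le_trans _ _ (`|h| * (2 * (`|p0| + `|p1|))))//.
    by rewrite ler_wpM2l// ler_pM.
  by move: hh; rewrite /small_time; lra.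
have s1 : `|h * ((1 + tnth x i) * (p0 + p1 * tnth x i))| <= 2^-1.
  by apply: small; rewrite ler_norml; apply/andP; split; lra.
have s2 : `|h * ((1 - tnth x i) * (p0 + p1 * tnth x i))| <= 2^-1.
  by apply: small; rewrite ler_norml; apply/andP; split; lra.
move: s1 s2; rewrite !ler_norml => /andP[_ s1] /andP[s2 _].
rewrite [RHS]mulrA; congr (_ * _); rewrite [RHS]mulrACA -!powRM; first last.
- lra.
- lra.
- lra.
- lra.
by rewrite /vfield; congr (_ `^ _ * _ `^ _); ring.
Qed.

End with_field.
End jacobi_change_of_variable.

(** * Bounded functions and first-order expansions *)

Section bounded_functions.
Context d (T : measurableType d) (R : realType) (nu : probability T R) (D : set T).
Hypothesis mD : measurable D.
Hypothesis nuD : nu D = 1%E.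

(** Boundedness is required only on [D], which carries all the mass: the statistics used later are
    polynomials, unbounded on the whole space. *)
Definition bmf (f : T -> R) :=
  measurable_fun setT f /\ exists M, forall x, D x -> `|f x| <= M.

Definition Ex (f : T -> R) : R := \int[nu]_(x in D) f x.

Lemma bmf_cst c : bmf (fun=> c).
Proof. by split; [exact: measurable_cst | exists `|c|]. Qed.

Lemma bmfD f g : bmf f -> bmf g -> bmf (fun x => f x + g x).
Proof.
move=> [mf [M fM]] [mg [K gK]]; split; first exact: measurable_funD.
by exists (M + K) => x Dx; rewrite (le_trans (ler_normD _ _))// lerD ?fM ?gK.
Qed.

Lemma bmfN f : bmf f -> bmf (fun x => - f x).
Proof.
move=> [mf [M fM]]; split; first exact: measurable_funN.
by exists M => x Dx; rewrite normrN fM.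
Qed.

Lemma bmfB f g : bmf f -> bmf g -> bmf (fun x => f x - g x).
Proof. by move=> bf bg; exact: bmfD bf (bmfN bg). Qed.

Lemma bmfM f g : bmf f -> bmf g -> bmf (fun x => f x * g x).
Proof.
move=> [mf [M fM]] [mg [K gK]]; split; first exact: measurable_funM.
by exists (M * K) => x Dx; rewrite normrM ler_pM ?fM ?gK.
Qed.

Lemma bmfX f k : bmf f -> bmf (fun x => f x ^+ k).
Proof.
move=> [mf [M fM]]; split; first exact: measurable_funX.
by exists (M ^+ k) => x Dx; rewrite normrX lerXn2r ?nnegrE ?fM// (le_trans _ (fM x Dx)).
Qed.

Lemma bmf_sum (I : finType) (F : I -> T -> R) :
  (forall i, bmf (F i)) -> bmf (fun x => \sum_i F i x).
Proof.
move=> bF; split; first by apply: measurable_sum => i; case: (bF i).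
have /choice[M MP] : forall i, exists M, forall x, D x -> `|F i x| <= M.
  by move=> i; case: (bF i).
exists (\sum_i M i) => x Dx; rewrite (le_trans (ler_norm_sum _ _ _))//.
by apply: ler_sum => i _; exact: MP.
Qed.

Lemma bmf_expR f : bmf f -> bmf (fun x => expR (f x)).
Proof.
move=> [mf [M fM]]; split; first exact: measurableT_comp.
exists (expR M) => x Dx; rewrite ger0_norm ?expR_ge0// ler_expR.
by rewrite (le_trans (ler_norm _))// fM.
Qed.

Lemma bmf_integrable f : bmf f -> nu.-integrable D (EFin \o f).
Proof.
move=> [mf [M fM]]; apply: measurable_bounded_integrable => //.
- by apply: (le_lt_trans (probability_le1 nu mD)); rewrite ltry.
- exact: measurable_funTS.
exists `|M|; split => // K MK x Dx.
by apply: (le_trans (fM x Dx)); rewrite (le_trans (ler_norm _))// ltW.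
Qed.

Lemma full_setI S : measurable S -> nu (S `&` D) = nu S.
Proof.
move=> mS; rewrite [RHS](measureDI _ mS mD).
rewrite [X in (X + _)%E](_ : _ = 0%E) ?add0e//; apply/eqP.
rewrite eq_le measure_ge0 andbT -(_ : nu (~` D) = 0%E).
  apply: le_measure; rewrite ?inE; [exact: measurableD|exact: measurableC|].
  exact: subIsetr.
by rewrite probability_setC// nuD subee.
Qed.

Lemma Ex_cst c : Ex (fun=> c) = c.
Proof. by rewrite /Ex Rintegral_cst// [X in fine X]nuD mulr1. Qed.

Lemma ExD f g : bmf f -> bmf g -> Ex (fun x => f x + g x) = Ex f + Ex g.
Proof. by move=> bf bg; rewrite /Ex RintegralD//; exact: bmf_integrable. Qed.

Lemma ExB f g : bmf f -> bmf g -> Ex (fun x => f x - g x) = Ex f - Ex g.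
Proof. by move=> bf bg; rewrite /Ex RintegralB//; exact: bmf_integrable. Qed.

Lemma ExZ c f : bmf f -> Ex (fun x => c * f x) = c * Ex f.
Proof. by move=> bf; rewrite /Ex RintegralZl//; exact: bmf_integrable. Qed.

Lemma eq_Ex f g : (forall x, D x -> f x = g x) -> Ex f = Ex g.
Proof. by move=> fg; apply: eq_Rintegral => x /[!inE] Dx; exact: fg. Qed.

Lemma le_Ex f g : bmf f -> bmf g -> (forall x, D x -> f x <= g x) -> Ex f <= Ex g.
Proof. by move=> bf bg fg; apply: le_Rintegral => //; exact: bmf_integrable. Qed.

Lemma Ex_ge0 f : (forall x, D x -> 0 <= f x) -> 0 <= Ex f.
Proof. exact: Rintegral_ge0. Qed.

Lemma norm_Ex_le f c : bmf f -> (forall x, D x -> `|f x| <= c) -> `|Ex f| <= c.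
Proof.
move=> bf fc.
have fc' x : D x -> - c <= f x <= c by move=> Dx; rewrite -ler_norml fc.
have lo : Ex (fun=> - c) <= Ex f.
  by apply: le_Ex => //; [exact: bmf_cst|move=> x /fc' /andP[]].
have hi : Ex f <= Ex (fun=> c).
  by apply: le_Ex => //; [exact: bmf_cst|move=> x /fc' /andP[]].
by move: lo hi; rewrite !Ex_cst ler_norml => -> ->.
Qed.

(* The little-o form of the expansion (rather than a quadratic remainder) makes
   jets stable under composition with a function differentiable at one point. *)
Definition jet (f : R -> T -> R) (f0 f1 : T -> R) :=
  (exists M, forall x, D x -> `|f0 x| <= M /\ `|f1 x| <= M) /\
  forall e, 0 < e -> \forall h \near (0 : R),
    forall x, D x -> `|f h x - f0 x - h * f1 x| <= e * `|h|.

Lemma jet_affine f0 f1 : bmf f0 -> bmf f1 -> jet (fun h x => f0 x + h * f1 x) f0 f1.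
Proof.
move=> [_ [M fM]] [_ [K gK]]; split.
  exists (Num.max M K) => x Dx; split; rewrite le_max.
    by rewrite fM.
  by rewrite gK ?orbT.
move=> e e0; near=> h => x Dx.
rewrite (_ : _ - _ - _ = 0); last by ring.
by rewrite normr0 mulr_ge0// ltW.
Unshelve. all: by end_near. Qed.

Lemma jet_cst f0 : bmf f0 -> jet (fun=> f0) f0 (fun=> 0).
Proof.
move=> bf; have := jet_affine bf (bmf_cst 0).
by congr jet; apply/funext => h; apply/funext => x; rewrite mulr0 addr0.
Qed.

Lemma eq_jet f g f0 f1 : (\forall h \near (0:R), forall x, D x -> f h x = g h x) ->
  jet f f0 f1 -> jet g f0 f1.
Proof.
move=> fg [bf jf]; split => // e e0; near=> h => x Dx.
have <- : f h x = g h x by move: x Dx; near: h.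
by move: x Dx; near: h; exact: jf.
Unshelve. all: by end_near. Qed.

Lemma eq_jet1 f f0 f1 g0 g1 :
  (forall x, D x -> f0 x = g0 x) -> (forall x, D x -> f1 x = g1 x) ->
  jet f f0 f1 -> jet f g0 g1.
Proof.
move=> fg0 fg1 [[M fM] jf]; split.
  by exists M => x Dx; rewrite -fg0// -fg1//; exact: fM.
move=> e e0; near=> h => x Dx; rewrite -fg0// -fg1//.
by move: x Dx; near: h; exact: jf.
Unshelve. all: by end_near. Qed.

Lemma jetD f f0 f1 g g0 g1 : jet f f0 f1 -> jet g g0 g1 ->
  jet (fun h x => f h x + g h x) (fun x => f0 x + g0 x) (fun x => f1 x + g1 x).
Proof.
move=> [[M fM] jf] [[K gK] jg]; split.
  exists (M + K) => x Dx; have [? ?] := fM x Dx; have [? ?] := gK x Dx.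
  by split; rewrite (le_trans (ler_normD _ _))// lerD.
move=> e e0; have e20 : 0 < e / 2 by rewrite divr_gt0.
near=> h.
have jfh : forall x, D x -> `|f h x - f0 x - h * f1 x| <= e / 2 * `|h|.
  by near: h; exact: jf.
have jgh : forall x, D x -> `|g h x - g0 x - h * g1 x| <= e / 2 * `|h|.
  by near: h; exact: jg.
move=> x Dx; have H1 := jfh x Dx; have H2 := jgh x Dx.
rewrite (_ : _ - _ = (f h x - f0 x - h * f1 x) + (g h x - g0 x - h * g1 x)); last by ring.
by rewrite (le_trans (ler_normD _ _))//; lra.
Unshelve. all: by end_near. Qed.

Lemma jetM f f0 f1 g g0 g1 : jet f f0 f1 -> jet g g0 g1 ->
  jet (fun h x => f h x * g h x) (fun x => f0 x * g0 x)
    (fun x => f0 x * g1 x + f1 x * g0 x).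
Proof.
move=> [[M' fM'] jf] [[K' gK'] jg].
pose M := 1 + `|M'| + `|K'|.
have M1 : 1 <= M by rewrite /M; have := normr_ge0 M'; have := normr_ge0 K'; lra.
have fM x : D x -> `|f0 x| <= M /\ `|f1 x| <= M.
  move=> /fM'[? ?]; have := ler_norm M'; have := normr_ge0 K'.
  by split; rewrite /M; lra.
have gK x : D x -> `|g0 x| <= M /\ `|g1 x| <= M.
  move=> /gK'[? ?]; have := ler_norm K'; have := normr_ge0 M'.
  by split; rewrite /M; lra.
have M0 : 0 <= M by lra.
split.
  exists (M * M + M * M) => x Dx; have [? ?] := fM x Dx; have [? ?] := gK x Dx.
  split; last by rewrite (le_trans (ler_normD _ _))// lerD// normrM ler_pM.
  by rewrite normrM (@le_trans _ _ (M * M))// ?ler_pM// lerDl mulr_ge0.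
move=> e e0.
(* The error consists of [h^2 f1 g1] and of terms linear in the two remainders. The latter get the
   rate [r], with total weight [5 M]; [s] bounds [|h|] in the former. *)
pose r := Num.min 1 (e / (16 * M)).
have r0 : 0 < r by rewrite lt_min ltr01 divr_gt0//; lra.
have r1 : r <= 1 by rewrite ge_min lexx.
have rM : r * (16 * M) <= e.
  by rewrite -ler_pdivlMr; [rewrite ge_min lexx orbT|lra].
pose s := Num.min 1 (e / (2 * (M * M))).
have MM : 0 < M * M by rewrite mulr_gt0//; lra.
have s0 : 0 < s by rewrite lt_min ltr01 divr_gt0//; lra.
have sM : s * (2 * (M * M)) <= e.
  by rewrite -ler_pdivlMr; [rewrite ge_min lexx orbT|lra].
near=> h.
have jfh : forall x, D x -> `|f h x - f0 x - h * f1 x| <= r * `|h|.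
  by near: h; exact: jf.
have jgh : forall x, D x -> `|g h x - g0 x - h * g1 x| <= r * `|h|.
  by near: h; exact: jg.
have hs : `|h| <= s.
  by near: h; apply/nbhs_ballP; exists s => //= h; rewrite /ball/= sub0r normrN => /ltW.
have h1 : `|h| <= 1 by rewrite (le_trans hs)// ge_min lexx.
move=> x Dx; have H1 := jfh x Dx; have H2 := jgh x Dx.
have [f0M f1M] := fM x Dx; have [g0M g1M] := gK x Dx.
set u := f h x - _ - _ in H1; set v := g h x - _ - _ in H2.
rewrite (_ : _ - _ = h * h * (f1 x * g1 x) + u * (g0 x + h * g1 x + v) +
   (f0 x + h * f1 x) * v); last by rewrite /u /v; ring.
have h0 := normr_ge0 h.
have K1 : `|h * h * (f1 x * g1 x)| <= `|h| * (s * (M * M)).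
  by rewrite !normrM -mulrA ler_wpM2l// ler_pM// ler_pM.
have K2 : `|u * (g0 x + h * g1 x + v)| <= r * `|h| * (3 * M).
  rewrite normrM ler_pM//.
  have : `|h * g1 x| <= 1 * M by rewrite normrM ler_pM.
  have : r * `|h| <= 1 * 1 by rewrite ler_pM// ltW.
  have := ler_normD (g0 x + h * g1 x) v; have := ler_normD (g0 x) (h * g1 x).
  lra.
have K3 : `|(f0 x + h * f1 x) * v| <= (2 * M) * (r * `|h|).
  rewrite normrM ler_pM//.
  have : `|h * f1 x| <= 1 * M by rewrite normrM ler_pM.
  have := ler_normD (f0 x) (h * f1 x); lra.
have E1 : `|h| * (s * (2 * (M * M))) <= `|h| * e by rewrite ler_wpM2l.
have E2 : `|h| * (r * (16 * M)) <= `|h| * e by rewrite ler_wpM2l.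
have E3 : 0 <= `|h| * e by rewrite mulr_ge0// ltW.
apply: (le_trans (ler_normD _ _)); apply: (le_trans (lerD (ler_normD _ _) (lexx _))).
lra.
Unshelve. all: by end_near. Qed.

(** The value at [h = 0] is the same constant [c] for every [x], so differentiability of [g] at the
    single point [c] gives an expansion uniform in [x]. *)
Lemma jet_comp (g : R -> R) (c dg : R) f f1 : is_derive c 1 g dg ->
  jet f (fun=> c) f1 -> jet (fun h x => g (f h x)) (fun=> g c) (fun x => dg * f1 x).
Proof.
move=> gd [[M' fM'] jf].
pose M := 1 + `|M'|.
have M1 : 1 <= M by rewrite /M; have := normr_ge0 M'; lra.
have fM x : D x -> `|f1 x| <= M.
  by move=> /fM'[_ ?]; have := ler_norm M'; rewrite /M; lra.
split.
  exists (`|g c| + `|dg| * M) => x Dx; split; first by rewrite lerDl mulr_ge0//; lra.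
  by rewrite normrM ler_wpDl// ler_wpM2l// fM.
(* The difference quotient is turned into a little-o bound that also covers [u = 0]. *)
have gt e : 0 < e -> \forall u \near (0 : R), `|g (c + u) - g c - u * dg| <= e * `|u|.
  move=> e0.
  have [dgc dgE] := gd.
  have : (fun h => h^-1 *: ((g \o shift c) (h *: 1) - g c)) @ 0^' --> dg.
    by rewrite -dgE; exact: dgc.
  move/cvgrPdist_le => /(_ _ e0); rewrite near_withinE => H.
  near=> u; have [->|u0] := eqVneq u 0; first by rewrite addr0 subrr mul0r subr0 !normr0 mulr0.
  have : `|dg - u^-1 *: ((g \o shift c) (u *: 1) - g c)| <= e.
    by move: u0; near: u.
  rewrite /= /GRing.scale /= mulr1 [u + c]addrC => K.
  have -> : g (c + u) - g c - u * dg = - u * (dg - u^-1 * (g (c + u) - g c)).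
    by field.
  by rewrite normrM normrN mulrC ler_wpM2r.
move=> e e0.
pose r1 := e / (4 * M); have r10 : 0 < r1 by rewrite divr_gt0//; lra.
pose r2 := Num.min 1 (e / (2 * (1 + `|dg|))).
have r20 : 0 < r2.
  by rewrite lt_min ltr01 divr_gt0// mulr_gt0//; have := normr_ge0 dg; lra.
have r21 : r2 <= 1 by rewrite ge_min lexx.
have r2d : r2 * (2 * (1 + `|dg|)) <= e.
  rewrite -ler_pdivlMr; first by rewrite ge_min lexx orbT.
  by rewrite mulr_gt0//; have := normr_ge0 dg; lra.
have /nbhs_ballP[del /= del0 gdel] := gt _ r10.
near=> h.
have jfh : forall x, D x -> `|f h x - c - h * f1 x| <= r2 * `|h|.
  by near: h; exact: jf.
have hs : `|h| * (2 * M) < del.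
  rewrite -ltr_pdivlMr; last lra.
  near: h; apply/nbhs_ballP; exists (del / (2 * M)) => //=.
    by rewrite divr_gt0//; lra.
  by move=> h; rewrite /ball/= sub0r normrN.
move=> x Dx; have H1 := jfh x Dx.
have h0 := normr_ge0 h.
have hf1 : `|h * f1 x| <= `|h| * M by rewrite normrM ler_wpM2l// fM.
have r2h : r2 * `|h| <= 1 * `|h| by rewrite ler_wpM2r.
have Mh : 1 * `|h| <= M * `|h| by rewrite ler_wpM2r.
have fc : `|f h x - c| <= 2 * M * `|h|.
  have := ler_normD (f h x - c - h * f1 x) (h * f1 x); rewrite subrK; lra.
have fdel : `|f h x - c| < del by lra.
have := gdel (f h x - c).
rewrite /ball/= sub0r normrN => /(_ fdel); rewrite subrKC => G.
have -> : g (f h x) - g c - h * (dg * f1 x) =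
  (g (f h x) - g c - (f h x - c) * dg) + (f h x - c - h * f1 x) * dg by ring.
rewrite (le_trans (ler_normD _ _))// normrM.
have A1 : r1 * `|f h x - c| <= r1 * (2 * M * `|h|) by rewrite ler_wpM2l// ltW.
have A2 : r1 * (2 * M * `|h|) = e / 2 * `|h|.
  by rewrite /r1; field; lra.
have A3 : `|f h x - c - h * f1 x| * `|dg| <= r2 * `|h| * `|dg| by rewrite ler_wpM2r.
have A4 : r2 * (2 * (1 + `|dg|)) * `|h| <= e * `|h| by rewrite ler_wpM2r.
have A5 : 0 <= r2 * `|h| by rewrite mulr_ge0// ltW.
lra.
Unshelve. all: by end_near. Qed.

(** As [f0] is not constant, [expR (f0 x)] is factored out; the remaining exponent starts at 0 and
    [jet_comp] applies. *)
Lemma jet_expR f f0 f1 : bmf f0 -> jet f f0 f1 ->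
  jet (fun h x => expR (f h x)) (fun x => expR (f0 x))
    (fun x => f1 x * expR (f0 x)).
Proof.
move=> bf0 jf.
have j0 : jet (fun h x => f h x + - f0 x) (fun=> 0) f1.
  apply: eq_jet1 (jetD jf (jet_cst (bmfN bf0))) => x _; first by rewrite subrr.
  by rewrite addr0.
have J := jetM (jet_cst (bmf_expR bf0)) (jet_comp (is_derive_expR 0) j0).
apply: eq_jet1 (eq_jet _ J) => [x _|x _|].
- by rewrite expR0 mulr1.
- by rewrite expR0 mul1r mul0r addr0 mulrC.
- by near=> h => x _; rewrite -expRD subrKC.
Unshelve. all: by end_near. Qed.

Lemma jet_sum (I : finType) (F : I -> R -> T -> R) (F0 F1 : I -> T -> R) :
  (forall i, jet (F i) (F0 i) (F1 i)) ->
  jet (fun h x => \sum_i F i h x) (fun x => \sum_i F0 i x) (fun x => \sum_i F1 i x).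
Proof.
move=> jF; elim: (index_enum I) => [|i s IHs].
  have := jet_cst (bmf_cst 0).
  by congr jet; (apply/funext => h; try (apply/funext => x)); rewrite !big_nil.
have := jetD (jF i) IHs.
by congr jet; (apply/funext => h; try (apply/funext => x)); rewrite !big_cons.
Qed.

(** All factors start at 1, so the product rule gives the plain sum of the first-order terms. *)
Lemma jet_prod1 (I : finType) (P : pred I) (F : I -> R -> T -> R) (F1 : I -> T -> R) :
  (forall i, P i -> jet (F i) (fun=> 1) (F1 i)) ->
  jet (fun h x => \prod_(i | P i) F i h x) (fun=> 1)
    (fun x => \sum_(i | P i) F1 i x).
Proof.
move=> jF; elim: (index_enum I) => [|i s IHs].
  have := jet_cst (bmf_cst 1).
  by congr jet; (apply/funext => h; try (apply/funext => x)); rewrite !big_nil.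
have [Pi|Pi] := boolP (P i); last first.
  move: IHs; congr jet;
    by (apply/funext => h; try (apply/funext => x)); rewrite !big_cons (negbTE Pi).
have := jetM (jF i Pi) IHs.
by congr jet; (apply/funext => h; try (apply/funext => x));
  rewrite ?big_cons ?Pi ?mul1r ?mulr1 // addrC.
Qed.

Lemma jet_Ex f f0 f1 : (\forall h \near (0 : R), bmf (f h)) -> bmf f0 -> bmf f1 ->
  jet f f0 f1 -> forall e, 0 < e ->
  \forall h \near (0 : R), `|Ex (f h) - Ex f0 - h * Ex f1| <= e * `|h|.
Proof.
move=> bf bf0 bf1 [_ jf] e e0; near=> h.
have bfh : bmf (f h) by near: h.
have bh : bmf (fun x => h * f1 x) by apply: bmfM => //; exact: bmf_cst.
rewrite -ExB// -ExZ// -ExB//; last exact: bmfB.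
apply: norm_Ex_le; first by apply: bmfB => //; exact: bmfB.
by near: h; exact: jf.
Unshelve. all: by end_near. Qed.

(** Constancy leaves [|h| |Ex f1| <= e |h|] for small [h]; one nonzero [h] gives [|Ex f1| <= e], for
    every [e]. *)
Lemma jet_Ex_cst f f0 f1 : (\forall h \near (0 : R), bmf (f h)) -> bmf f0 -> bmf f1 ->
  jet f f0 f1 -> (\forall h \near (0 : R), Ex (f h) = Ex f0) -> Ex f1 = 0.
Proof.
move=> bf bf0 bf1 jf fE; apply/eqP; rewrite -normr_le0.
apply/ler_addgt0Pl => e e0; rewrite addr0.
have : \forall h \near (0 : R), `|h| * `|Ex f1| <= e * `|h|.
  have := jet_Ex bf bf0 bf1 jf e0; apply: filterS2 fE => h ->.
  by rewrite subrr sub0r normrN normrM.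
move=> /nbhs_ballP[r /= r0 /(_ (r / 2))].
have r2 : 0 < r / 2 by rewrite divr_gt0.
rewrite /ball/= sub0r normrN gtr0_norm// [leLHS]mulrC.
by rewrite ler_pM2r//; apply; lra.
Qed.

(** * Exponential moments and Chernoff bounds *)

Definition mgf (U : T -> R) (t : R) := Ex (fun x => expR (t * U x)).

Lemma is_derive_mgf U (t : R) : bmf U ->
  is_derive t 1 (mgf U) (Ex (fun x => U x * expR (t * U x))).
Proof.
move=> bU.
have be s : bmf (fun x => expR (s * U x)).
  by apply: bmf_expR; apply: bmfM => //; exact: bmf_cst.
have bUe : bmf (fun x => U x * expR (t * U x)) by exact: bmfM.
pose f h x := expR ((t + h) * U x).
have jf : jet f (fun x => expR (t * U x)) (fun x => U x * expR (t * U x)).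
  have := jetM (jet_cst (be t)) (jet_comp (is_derive_expR 0)
    (jet_affine (bmf_cst 0) bU)).
  move=> J; apply: (eq_jet1 _ _ (eq_jet _ J)); last first.
  - by near=> h => x _; rewrite /f add0r -expRD -mulrDl.
  - by move=> x _; rewrite expR0 mul1r mul0r addr0 mulrC.
  - by move=> x _; rewrite expR0 mulr1.
have H : (fun h => h^-1 *: ((mgf U \o shift t) (h *: (1 : R)) - mgf U t)) @ 0^' -->
    Ex (fun x => U x * expR (t * U x)).
  apply/cvgrPdist_le => e e0; rewrite near_withinE.
  have bf : \forall h \near (0 : R), bmf (f h) by near=> h; exact: be.
  have := jet_Ex bf (be t) bUe jf e0; apply: filterS => h K h0.
  rewrite /= /GRing.scale /= mulr1 [h + t]addrC -(ler_pM2r (x := `|h|)) ?normr_gt0//.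
  rewrite -normrM (_ : _ * h = - (mgf U (t + h) - mgf U t -
    h * Ex (fun x => U x * expR (t * U x)))); last by field.
  by rewrite normrN.
split; first by apply/cvg_ex; exists (Ex (fun x => U x * expR (t * U x))).
exact: cvg_lim.
Unshelve. all: by end_near. Qed.

(** A Gronwall argument: by hypothesis the product of [mgf U s] with [exp (- (A s + B s^2))] has
    nonpositive derivative on [0, t], and it equals 1 at 0. *)
Lemma mgf_le U (A B t : R) : bmf U -> 0 <= t ->
  (forall s, 0 <= s <= t ->
    Ex (fun x => U x * expR (s * U x)) <= (A + 2 * B * s) * mgf U s) ->
  mgf U t <= expR (A * t + B * t ^+ 2).
Proof.
move=> bU; rewrite le_eqVlt => /predU1P[<- _|t0 H].
  rewrite /mgf (eq_Ex (g := fun=> 1)) => [|x _]; last by rewrite mul0r expR0.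
  by rewrite Ex_cst expr0n/= !mulr0 addr0 expR0.
pose E s := expR (- (A * s + B * s ^+ 2)).
pose dE s := - (A + 2 * B * s) * E s.
have EdE s : is_derive (s : R) 1 E (dE s).
  pose q (s : R) := - (A * s + B * s ^+ 2).
  have qd : is_derive s 1 q (- (A + 2 * B * s)).
    by rewrite /q; apply: is_derive_eq; rewrite /GRing.scale/=; ring.
  have := is_derive1_comp (is_derive_expR (q s)) qd.
  by rewrite mulrC.
have GdE s : is_derive (s : R) 1 (fun s => mgf U s * E s)
    ((Ex (fun x => U x * expR (s * U x)) - (A + 2 * B * s) * mgf U s) * E s).
  have := is_deriveM (is_derive_mgf s bU) (EdE s).
  move=> K; apply: (is_derive_eq K); rewrite /GRing.scale/= /dE; ring.
have [|c cI] := MVT t0 (fun s _ => GdE s).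
  apply: continuous_subspaceT => s.
  by apply: differentiable_continuous; apply/derivable1_diffP; have [] := GdE s.
have -> : mgf U 0 * E 0 = 1.
  rewrite /E mulr0 expr0n mulr0 addr0 oppr0 expR0 mulr1.
  rewrite /mgf (eq_Ex (g := fun=> 1)) => [|x _]; last by rewrite mul0r expR0.
  exact: Ex_cst.
move=> K.
have : mgf U t * E t <= 1.
  rewrite -subr_le0 K pmulr_lle0 ?subr0// pmulr_lle0 ?expR_gt0// subr_le0.
  by apply: H; move: cI; rewrite in_itv/= => /andP[? ?]; rewrite !ltW.
by rewrite /E expRN ler_pdivrMr ?expR_gt0// mul1r.
Qed.

(** Markov's inequality for [exp (t U)]: the indicator of [u < U] is at most [exp (t U - t u)]. *)
Lemma chernoff_mgf U (A B t u : R) : bmf U -> 0 <= t ->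
  (forall s, 0 <= s <= t ->
    Ex (fun x => U x * expR (s * U x)) <= (A + 2 * B * s) * mgf U s) ->
  (nu [set x | (u < U x)%R] <= (expR (A * t + B * t ^+ 2 - t * u))%:E)%E.
Proof.
move=> bU t0 H.
have mS : measurable [set x | u < U x].
  by apply: measurable_set_pred; apply: measurable_fun_ltr => //; case: bU.
have b1 : bmf (\1_[set x | u < U x]).
  split; first exact: measurable_indic.
  by exists 1 => x _; rewrite indicE; case: (_ \in _); rewrite ?normr1 ?normr0.
have -> : nu [set x | u < U x] = (Ex (\1_[set x | u < U x]))%:E.
  rewrite /Ex /Rintegral fineK; last first.
    by apply: integrable_fin_num => //; exact: bmf_integrable.
  by rewrite integral_indic//; exact/esym/full_setI.
have bu : bmf (fun x => expR (- (t * u)) * expR (t * U x)).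
  apply: bmfM; first exact: bmf_cst.
  by apply: bmf_expR; apply: bmfM => //; exact: bmf_cst.
rewrite lee_fin expRD mulrC (@le_trans _ _ (expR (- (t * u)) * mgf U t))//.
  rewrite -ExZ; last by apply: bmf_expR; apply: bmfM => //; exact: bmf_cst.
  apply: le_Ex => // x _; rewrite -expRD indicE.
  case: (boolP (x \in _)) => xS; last exact: expR_ge0.
  rewrite -expR0 ler_expR; move: xS; rewrite inE/= => uU.
  have : t * u <= t * U x by rewrite ler_wpM2l// ltW.
  lra.
by rewrite ler_wpM2l ?expR_ge0// mgf_le.
Qed.

End bounded_functions.

(** * Integration by parts for the Jacobi ensemble *)

Section jacobi_law.
Context (R : realType) (beta a b : R) (n : nat).
Local Notation Rn := (n.-tuple (measurableTypeR R)).
Local Notation D := (@ordered_cube R n).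
Local Notation w := (@jacobi_weight R beta a b n).
Context (nu : probability Rn R) (k : R).
Hypothesis k0 : 0 < k.
Hypothesis nuE : forall A : set Rn, measurable A ->
  nu A = (k%:E * \int[tuple_lebesgue_measure R n]_(x in A) (w x)%:E)%E.

Let mD : measurable D. Proof. exact: measurable_ordered_cube. Qed.

Lemma jacobi_law_cube : nu D = 1%E.
Proof.
have nuC0 : nu (~` D) = 0%E.
  rewrite nuE; last exact: measurableC.
  rewrite integral0_eq ?mule0// => x Dx.
  by rewrite jacobi_weight_out.
have := probability_setC nu (measurableC mD).
by rewrite setCK nuC0 sube0.
Qed.

Let nuD := jacobi_law_cube.

Section with_field.
Variables p0 p1 : R.
Local Notation J := (@jacobian R beta a b n p0 p1).
Local Notation Tf := (@tuple_flow R n p0 p1).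

Lemma ge0_integral_jacobi_flow h (f : Rn -> \bar R) : small_time p0 p1 h ->
  measurable_fun setT f -> (forall x, 0 <= f x)%E ->
  (\int[nu]_x f x = \int[nu]_x (f (Tf h x) * (J h x)%:E))%E.
Proof.
move=> hh mf f0.
pose g (x : Rn) := k * w x.
have mw := @measurable_jacobi_weight R beta a b n.
have mg : measurable_fun setT g by apply: measurable_funM.
have g0 x : 0 <= g x by rewrite mulr_ge0 ?jacobi_weight_ge0// ltW.
have nugE A : measurable A ->
    nu A = (\int[tuple_lebesgue_measure R n]_(x in A) (g x)%:E)%E.
  move=> mA; rewrite nuE// -ge0_integralZl//; last 3 first.
  - by apply/measurable_EFinP; exact: measurable_funTS.
  - by move=> x _; rewrite lee_fin jacobi_weight_ge0.
  - by rewrite lee_fin ltW.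
have mT := @measurable_tuple_flow R n p0 p1 h.
have mfT : measurable_fun setT (f \o Tf h) by exact: measurableT_comp.
have mJ := @measurable_jacobian R beta a b n p0 p1 h.
rewrite (ge0_integral_density g0 mg nugE)//.
rewrite [RHS](ge0_integral_density g0 mg nugE)//; last 2 first.
- by apply: emeasurable_funM => //; exact/measurable_EFinP.
- by move=> x _; rewrite mule_ge0// lee_fin jacobian_ge0.
rewrite (ge0_integral_tuple_change_of_variable (measurable_flow p0 p1 h)
  (measurable_dflow p0 p1 h) (dflow_ge0 hh))//; first last.
- by move=> x; rewrite mule_ge0// lee_fin.
- by apply: emeasurable_funM => //; exact/measurable_EFinP.
- by move=> F mF F0; exact: ge0_integral_flow.
apply: eq_integral => x _; rewrite -!muleA; congr (_ * _)%E.
rewrite -!EFinM; congr EFin; rewrite /g -[LHS]mulrA [X in k * X = _](jacobi_weight_flow beta a b x hh).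
by rewrite [RHS]mulrCA [J h x * _]mulrC.
Qed.

(** The divergence of the field [v] with respect to the Jacobi weight, [sum (v d_i log w + v')],
    with the poles of [d_i log w] cancelled by the zeros of [v]. *)
Definition jacobian1 (x : Rn) : R :=
  \sum_(i < n) (\sum_(j < n | (i < j)%N)
     beta * vslope p0 p1 (tnth x i) (tnth x j)) +
  \sum_(i < n) ((a - 1) * - ((1 + tnth x i) * (p0 + p1 * tnth x i)) +
    (b - 1) * ((1 - tnth x i) * (p0 + p1 * tnth x i)) +
    vslope p0 p1 (tnth x i) (tnth x i)).

Let bt i : bmf D (fun x => tnth x i).
Proof.
split; first exact: measurable_tnth.
by exists 1 => x Dx; rewrite ler_norml ordered_cube_itv.
Qed.

Let bp i : bmf D (fun x : Rn => p0 + p1 * tnth x i).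
Proof. by apply: bmfD; [exact: bmf_cst|apply: bmfM => //; exact: bmf_cst]. Qed.

Let bs i j : bmf D (fun x : Rn => vslope p0 p1 (tnth x i) (tnth x j)).
Proof.
apply: bmfB; apply: bmfM; try exact: bmf_cst; last exact: bmfD.
apply: bmfB; last exact: bmfX.
apply: bmfB; last exact: bmfM.
by apply: bmfB; [exact: bmf_cst|exact: bmfX].
Qed.

Let jet_powR (c : R) (f1 : Rn -> R) : bmf D f1 ->
  jet D (fun h x => (1 + h * f1 x) `^ c) (fun=> 1) (fun x => c * f1 x).
Proof.
move=> bf; have := jet_comp (is_derive1_powR c ltr01) (jet_affine (bmf_cst D 1) bf).
by rewrite !powR1 mulr1.
Qed.

Lemma jet_jacobian : jet D J (fun=> 1) jacobian1.
Proof.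
rewrite /jacobian.
have J1 : jet D (fun h (x : Rn) => \prod_(i < n) \prod_(j < n | (i < j)%N)
      (1 + h * vslope p0 p1 (tnth x i) (tnth x j)) `^ beta) (fun=> 1)
    (fun x => \sum_(i < n) (\sum_(j < n | (i < j)%N)
     beta * vslope p0 p1 (tnth x i) (tnth x j))).
  by apply: jet_prod1 => i _; apply: jet_prod1 => j _; exact: jet_powR.
have J2 : jet D (fun h (x : Rn) => \prod_(i < n)
    ((1 - h * ((1 + tnth x i) * (p0 + p1 * tnth x i))) `^ (a - 1) *
     (1 + h * ((1 - tnth x i) * (p0 + p1 * tnth x i))) `^ (b - 1) *
     dflow p0 p1 h (tnth x i))) (fun=> 1)
   (fun x => \sum_(i < n) ((a - 1) * - ((1 + tnth x i) * (p0 + p1 * tnth x i)) +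
    (b - 1) * ((1 - tnth x i) * (p0 + p1 * tnth x i)) +
    vslope p0 p1 (tnth x i) (tnth x i))).
  apply: jet_prod1 => i _.
  have K1 : jet D (fun h (x : Rn) =>
      (1 - h * ((1 + tnth x i) * (p0 + p1 * tnth x i))) `^ (a - 1)) (fun=> 1)
      (fun x => (a - 1) * - ((1 + tnth x i) * (p0 + p1 * tnth x i))).
    have : bmf D (fun x : Rn => - ((1 + tnth x i) * (p0 + p1 * tnth x i))).
      by apply: bmfN; apply: bmfM => //; apply: bmfD => //; exact: bmf_cst.
    move/(jet_powR (a - 1)); congr jet.
    by apply/funext => h; apply/funext => x; rewrite mulrN.
  have K2 : jet D (fun h (x : Rn) =>
      (1 + h * ((1 - tnth x i) * (p0 + p1 * tnth x i))) `^ (b - 1)) (fun=> 1)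
      (fun x => (b - 1) * ((1 - tnth x i) * (p0 + p1 * tnth x i))).
    by apply: jet_powR; apply: bmfM => //; apply: bmfB => //; exact: bmf_cst.
  have K3 : jet D (fun h (x : Rn) => dflow p0 p1 h (tnth x i)) (fun=> 1)
      (fun x => vslope p0 p1 (tnth x i) (tnth x i)).
    apply: eq_jet (jet_affine (bmf_cst D 1) (bs i i)).
    by near=> h => x Dx; rewrite /dflow ordered_cube_itv.
  apply: eq_jet1 (jetM (jetM K1 K2) K3) => x _; first by rewrite !mulr1.
  by rewrite !mul1r !mulr1; ring.
apply: eq_jet1 (jetM J1 J2) => x _; first by rewrite mulr1.
by rewrite mul1r mulr1 addrC.
Unshelve. all: by end_near. Qed.

(** A uniform expansion around bounded functions is itself bounded, which supplies integrability for
    all small [h] without separate estimates of the Jacobian. *)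
Lemma jet_bmf (f : R -> Rn -> R) f0 f1 : jet D f f0 f1 ->
  (forall h, measurable_fun setT (f h)) -> \forall h \near (0 : R), bmf D (f h).
Proof.
move=> [[M fM] jf] mf; near=> h; split => //.
have H : forall x, D x -> `|f h x - f0 x - h * f1 x| <= 1 * `|h|.
  by near: h; apply: jf.
exists (`|h| + M + `|h| * M) => x Dx; have [f0M f1M] := fM x Dx.
have := H x Dx; rewrite mul1r => K.
rewrite (_ : f h x = (f h x - f0 x - h * f1 x) + f0 x + h * f1 x); last by ring.
rewrite (le_trans (ler_normD _ _))// lerD//; last by rewrite normrM ler_wpM2l.
by rewrite (le_trans (ler_normD _ _))// lerD.
Unshelve. all: by end_near. Qed.

Lemma near_small_time : \forall h \near (0 : R), small_time p0 p1 h.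
Proof.
pose M := 1 + 4 * (`|p0| + `|p1|).
have M0 : 0 < M by rewrite /M; have := normr_ge0 p0; have := normr_ge0 p1; lra.
apply/nbhs_ballP; exists M^-1 => /=; first by rewrite invr_gt0.
move=> h; rewrite /ball/= sub0r normrN -[M^-1]mul1r ltr_pdivlMr// /small_time /M.
by have := normr_ge0 h; lra.
Qed.

(** Invariance is available for nonnegative functions. A bounded [f] is shifted by a constant [M],
    and the formula for the constant is subtracted. *)
Lemma Ex_jacobi_flow h (f : Rn -> R) : small_time p0 p1 h ->
  bmf D f -> bmf D (J h) -> bmf D (fun x => f (Tf h x) * J h x) ->
  Ex nu D (fun x => f (Tf h x) * J h x) = Ex nu D f.
Proof.
move=> hh bf bJ bfJ.
have mT := @measurable_tuple_flow R n p0 p1 h.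
have pos g : bmf D g -> (forall x, D x -> 0 <= g x) ->
    Ex nu D (fun x => g (Tf h x) * J h x) = Ex nu D g.
  move=> [mg _] g0; congr fine.
  have mgD : measurable_fun setT ((EFin \o g) \_ D).
    have mgD' : measurable_fun D (EFin \o g).
      by apply/measurable_EFinP; exact: measurable_funTS.
    exact/(measurable_restrictT _ mD).
  rewrite [RHS]integral_mkcond [RHS](ge0_integral_jacobi_flow hh mgD); last first.
    by move=> x; rewrite patchE; case: ifPn => //; rewrite inE => /g0; rewrite lee_fin.
  rewrite [LHS]integral_mkcond; apply: eq_integral => x _; rewrite !patchE.
  rewrite (_ : (Tf h x \in D) = (x \in D)).
    by case: ifPn; rewrite ?mul0e// EFinM.
  by apply/idP/idP; rewrite !inE ordered_cube_flow.
have [M0 fM0] := bf.2.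
pose M := `|M0|.
have bM : bmf D (fun=> M) := bmf_cst D M.
have E1 := pos _ (bmfD bf bM) _.
have E2 := pos _ bM _.
have E3 : Ex nu D (fun x => M * J h x) = Ex nu D (fun=> M).
  by apply: E2 => x _; exact: normr_ge0.
have E4 : Ex nu D (fun x => (f (Tf h x) + M) * J h x) = Ex nu D (fun x => f x + M).
  apply: E1 => x Dx; have := fM0 x Dx; rewrite ler_norml => /andP[+ _].
  by have := ler_norm M0; rewrite /M; lra.
apply: (addIr (Ex nu D (fun=> M))); rewrite -(ExD nu mD bf bM) -E4 -E3.
rewrite -(ExD nu mD bfJ (bmfM bM bJ)).
by apply: eq_Ex => x _; rewrite mulrDl.
Qed.

Lemma bmf_jacobian1 : bmf D jacobian1.
Proof.
apply: bmfD.
  apply: bmf_sum => i.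
  rewrite (_ : (fun _ => _) = (fun x : Rn => \sum_(j < n)
    (if (i < j)%N then beta * vslope p0 p1 (tnth x i) (tnth x j) else 0))); last first.
    by apply/funext => x; rewrite big_mkcond.
  apply: bmf_sum => j; case: ltnP => _; last exact: bmf_cst.
  by apply: bmfM => //; exact: bmf_cst.
apply: bmf_sum => i; apply: bmfD => //; apply: bmfD; apply: bmfM;
  try exact: bmf_cst.
- by apply: bmfN; apply: bmfM => //; apply: bmfD => //; exact: bmf_cst.
- by apply: bmfM => //; apply: bmfB => //; exact: bmf_cst.
Qed.

(** The expectation of [f (T x)] times the Jacobian does not depend on the time [h], so its
    first-order coefficient vanishes. *)
Lemma Ex_jacobi_ibp (f f1 : Rn -> R) : bmf D f -> bmf D f1 ->
  jet D (fun h x => f (Tf h x)) f f1 ->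
  Ex nu D (fun x => f1 x + f x * jacobian1 x) = 0.
Proof.
move=> bf bf1 jf; have bJ1 := bmf_jacobian1.
have mfT h : measurable_fun setT (fun x => f (Tf h x)).
  by apply: (measurableT_comp bf.1); exact: measurable_tuple_flow.
have mJ h := @measurable_jacobian R beta a b n p0 p1 h.
have jfJ := jetM jf jet_jacobian.
have bJ := jet_bmf jet_jacobian mJ.
have bfJ := jet_bmf jfJ (fun h => measurable_funM (mfT h) (mJ h)).
have jfJ' : jet D (fun h x => f (Tf h x) * J h x) f
    (fun x => f1 x + f x * jacobian1 x).
  by apply: eq_jet1 jfJ => x _; rewrite mulr1// addrC.
apply: (jet_Ex_cst mD nuD _ _ _ jfJ') => //.
  by apply: bmfD => //; exact: bmfM.
near=> h; apply: Ex_jacobi_flow => //; by near: h; try exact: near_small_time.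
Unshelve. all: by end_near. Qed.

End with_field.
End jacobi_law.

(** Pair sums become full double sums minus the diagonal, and these are expressible by power
    sums. *)
Lemma sum_lt_sym (R : comPzRingType) n (f : 'I_n -> 'I_n -> R) :
  (forall i j, f i j = f j i) ->
  2 * (\sum_(i < n) \sum_(j < n | (i < j)%N) f i j) =
  \sum_(i < n) \sum_(j < n) f i j - \sum_(i < n) f i i.
Proof.
move=> fC.
have gtE : \sum_(i < n) \sum_(j < n | (j < i)%N) f i j =
    \sum_(i < n) \sum_(j < n | (i < j)%N) f i j.
  rewrite (exchange_big_dep predT)//=; apply: eq_bigr => i _.
  by apply: eq_bigr => j _; rewrite fC.
apply/eqP; rewrite eq_sym subr_eq; apply/eqP.
rewrite mulr_natl mulr2n -{2}gtE -!big_split/=; apply: eq_bigr => i _.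
rewrite (bigID (fun j : 'I_n => (i < j)%N))/= -addrA; congr (_ + _).
rewrite (bigD1 i)/=; last by rewrite ltnn.
rewrite addrC; congr (_ + _); apply: eq_bigl => j.
by rewrite -leqNgt [in RHS]ltn_neqAle andbC.
Qed.

(** * Linear and quadratic statistics, and the divergences of the two fields *)

Section jacobi_statistics.
Context (R : realType) (beta a b : R) (n : nat).
Local Notation Rn := (n.-tuple (measurableTypeR R)).
Local Notation D := (@ordered_cube R n).
Local Notation w := (@jacobi_weight R beta a b n).
Context (nu : probability Rn R) (k : R).
Hypothesis k0 : 0 < k.
Hypothesis nuE : forall A : set Rn, measurable A ->
  nu A = (k%:E * \int[tuple_lebesgue_measure R n]_(x in A) (w x)%:E)%E.

Let mD : measurable D. Proof. exact: measurable_ordered_cube. Qed.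
Let nuD : nu D = 1%E. Proof. exact: (jacobi_law_cube nuE). Qed.

Variable m : R.
Let N : R := a + b + beta * (n%:R - 1).
Hypothesis mN : m * N = b - a.

Definition dev (x : Rn) : R := \sum_(i < n) (tnth x i - m).
Definition sqdev (x : Rn) : R := \sum_(i < n) (tnth x i - m) ^+ 2.
(* With the carre du champ [Gamma(f, g) = sum (1 - x_i^2) d_i f d_i g], the next
   three functions are [Gamma(dev, dev)], [Gamma(dev, sqdev)] and
   [Gamma(sqdev, sqdev) / 2]. *)
Definition carre (x : Rn) : R := \sum_(i < n) (1 - tnth x i ^+ 2).
Definition carre_sqdev (x : Rn) : R :=
  \sum_(i < n) 2 * (tnth x i - m) * (1 - tnth x i ^+ 2).
Definition carre_sqdev2 (x : Rn) : R :=
  \sum_(i < n) 2 * (tnth x i - m) ^+ 2 * (1 - tnth x i ^+ 2).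

Let bt i : bmf D (fun x => tnth x i).
Proof.
split; first exact: measurable_tnth.
by exists 1 => x Dx; rewrite ler_norml ordered_cube_itv.
Qed.

Let btm i : bmf D (fun x => tnth x i - m).
Proof. by apply: bmfB => //; exact: bmf_cst. Qed.

Lemma bmf_dev : bmf D dev. Proof. exact: bmf_sum. Qed.

Lemma bmf_sqdev : bmf D sqdev.
Proof. by apply: bmf_sum => i; exact: bmfX. Qed.

Lemma bmf_carre : bmf D carre.
Proof. by apply: bmf_sum => i; apply: bmfB; [exact: bmf_cst|exact: bmfX]. Qed.

Lemma bmf_carre_sqdev : bmf D carre_sqdev.
Proof.
apply: bmf_sum => i; apply: bmfM.
  by apply: bmfM => //; exact: bmf_cst.
by apply: bmfB; [exact: bmf_cst|exact: bmfX].
Qed.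

Lemma bmf_carre_sqdev2 : bmf D carre_sqdev2.
Proof.
apply: bmf_sum => i; apply: bmfM.
  by apply: bmfM; [exact: bmf_cst|exact: bmfX].
by apply: bmfB; [exact: bmf_cst|exact: bmfX].
Qed.

(** Joint exponential of both statistics, so that a single integration by parts serves the two
    tails. *)
Definition gauss (s t : R) (x : Rn) := expR (s * dev x + t * sqdev x).

Lemma bmf_gauss s t : bmf D (gauss s t).
Proof.
apply: bmf_expR; apply: bmfD; apply: bmfM; try exact: bmf_cst.
  exact: bmf_dev.
exact: bmf_sqdev.
Qed.

Let bv p0 p1 i : bmf D (fun x : Rn => vfield p0 p1 (tnth x i)).
Proof.
apply: bmfM; first by apply: bmfB; [exact: bmf_cst|exact: bmfX].
by apply: bmfD; [exact: bmf_cst|apply: bmfM => //; exact: bmf_cst].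
Qed.

Let jet_tnth p0 p1 i :
  jet D (fun h x => tnth (tuple_flow p0 p1 h x) i - m)
    (fun x => tnth x i - m) (fun x => vfield p0 p1 (tnth x i)).
Proof.
apply: eq_jet (jet_affine (btm i) (bv p0 p1 i)).
near=> h => x Dx; rewrite tnth_map /flow ordered_cube_itv//; ring.
Unshelve. all: by end_near. Qed.

Definition vdev p0 p1 (x : Rn) := \sum_(i < n) vfield p0 p1 (tnth x i).
Definition vsqdev p0 p1 (x : Rn) :=
  \sum_(i < n) 2 * (tnth x i - m) * vfield p0 p1 (tnth x i).

Lemma bmf_vdev p0 p1 : bmf D (vdev p0 p1).
Proof. exact: bmf_sum. Qed.

Lemma bmf_vsqdev p0 p1 : bmf D (vsqdev p0 p1).
Proof.
by apply: bmf_sum => i; apply: bmfM => //; apply: bmfM => //; exact: bmf_cst.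
Qed.

(** Test functions [(c0 + c1 S) exp (s S + t W)]; every moment identity below is obtained from this
    one by choosing the field and the four parameters. *)
Lemma Ex_gauss_ibp p0 p1 c0 c1 s t :
  Ex nu D (fun x => (c1 * vdev p0 p1 x + (c0 + c1 * dev x) *
    (s * vdev p0 p1 x + t * vsqdev p0 p1 x + jacobian1 beta a b p0 p1 x)) *
    gauss s t x) = 0.
Proof.
have bvd := bmf_vdev p0 p1; have bvs := bmf_vsqdev p0 p1.
have jd : jet D (fun h x => dev (tuple_flow p0 p1 h x)) dev (vdev p0 p1).
  by apply: jet_sum => i; exact: jet_tnth.
have js : jet D (fun h x => sqdev (tuple_flow p0 p1 h x)) sqdev (vsqdev p0 p1).
  apply: jet_sum => i.
  apply: eq_jet1 (jetM (jet_tnth p0 p1 i) (jet_tnth p0 p1 i)) => x _.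
    by rewrite expr2.
  by ring.
have jc c := jet_cst (bmf_cst D (c : R)).
have be : bmf D (fun x => s * dev x + t * sqdev x).
  by apply: bmfD; apply: bmfM; try exact: bmf_cst; [exact: bmf_dev|exact: bmf_sqdev].
have je := jet_expR be (jetD (jetM (jc s) jd) (jetM (jc t) js)).
have jf := jetM (jetD (jc c0) (jetM (jc c1) jd)) je.
have bl : bmf D (fun x => c0 + c1 * dev x).
  apply: bmfD; first exact: bmf_cst.
  by apply: bmfM; [exact: bmf_cst|exact: bmf_dev].
have b1 : bmf D (fun x => (c1 * vdev p0 p1 x + (c0 + c1 * dev x) *
    (s * vdev p0 p1 x + t * vsqdev p0 p1 x)) * gauss s t x).
  apply: bmfM; last exact: bmf_gauss.
  apply: bmfD; first by apply: bmfM => //; exact: bmf_cst.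
  by apply: bmfM => //; apply: bmfD; apply: bmfM => //; exact: bmf_cst.
have jf' : jet D (fun h x => (c0 + c1 * dev (tuple_flow p0 p1 h x)) *
    gauss s t (tuple_flow p0 p1 h x)) (fun x => (c0 + c1 * dev x) * gauss s t x)
    (fun x => (c1 * vdev p0 p1 x + (c0 + c1 * dev x) *
    (s * vdev p0 p1 x + t * vsqdev p0 p1 x)) * gauss s t x).
  by apply: eq_jet1 jf => x _ //; rewrite /gauss; ring.
have bf : bmf D (fun x => (c0 + c1 * dev x) * gauss s t x).
  by apply: bmfM => //; exact: bmf_gauss.
rewrite -[RHS](Ex_jacobi_ibp k0 nuE bf b1 jf').
by apply: eq_Ex => x _; ring.
Qed.

Let sum_quadratic (x : Rn) (c0 c1 c2 : R) :
  \sum_(i < n) (c0 + c1 * tnth x i + c2 * tnth x i ^+ 2) =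
  n%:R * c0 + c1 * (\sum_(i < n) tnth x i) + c2 * (\sum_(i < n) tnth x i ^+ 2).
Proof.
rewrite !big_split/= -!mulr_sumr; congr (_ + _ + _).
by rewrite sumr_const card_ord mulr_natl.
Qed.

Lemma devE x : dev x = \sum_(i < n) tnth x i - n%:R * m.
Proof.
transitivity (\sum_(i < n) (- m + 1 * tnth x i + 0 * tnth x i ^+ 2)).
  by apply: eq_bigr => i _; ring.
rewrite sum_quadratic; ring.
Qed.

Let sqdevE x : sqdev x = \sum_(i < n) tnth x i ^+ 2 -
  2 * m * (\sum_(i < n) tnth x i) + n%:R * m ^+ 2.
Proof.
transitivity (\sum_(i < n) (m ^+ 2 + (- (2 * m)) * tnth x i + 1 * tnth x i ^+ 2)).
  by apply: eq_bigr => i _; ring.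
rewrite sum_quadratic; ring.
Qed.

(** The pairs contribute [- beta (n - 1) X] and the single points [n (b - a) - (a + b) X], where
    [X = sum x_i]; with [n (b - a) = n m N] the total is a multiple of [X - n m]. *)
Lemma jacobian1_const x : jacobian1 beta a b 1 0 x = - (N * dev x).
Proof.
set X := \sum_(i < n) tnth x i; set Q := \sum_(i < n) tnth x i ^+ 2.
have pairs : \sum_(i < n) (\sum_(j < n | (i < j)%N)
    beta * vslope 1 0 (tnth x i) (tnth x j)) = - (beta * (n%:R - 1) * X).
  have H := @sum_lt_sym R n (fun i j => beta * vslope 1 0 (tnth x i) (tnth x j)).
  have {}H := H (fun i j => ltac:(rewrite /vslope; ring)).
  suff : 2 * - (beta * (n%:R - 1) * X) = 2 * (\sum_(i < n) (\sum_(j < n | (i < j)%N)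
      beta * vslope 1 0 (tnth x i) (tnth x j))) by lra.
  rewrite H.
  have -> : \sum_(i < n) \sum_(j < n) beta * vslope 1 0 (tnth x i) (tnth x j) =
      - (2 * beta * n%:R * X).
    transitivity (\sum_(i < n) (- (beta * X) + (- (beta * n%:R)) * tnth x i +
        0 * tnth x i ^+ 2)).
      apply: eq_bigr => i _.
      transitivity (\sum_(j < n) (- (beta * tnth x i) + (- beta) * tnth x j +
        0 * tnth x j ^+ 2)).
        by apply: eq_bigr => j _; rewrite /vslope; ring.
      by rewrite sum_quadratic -/X -/Q; ring.
    by rewrite sum_quadratic -/X -/Q; ring.
  have -> : \sum_(i < n) beta * vslope 1 0 (tnth x i) (tnth x i) =
      - (2 * beta * X).
    transitivity (\sum_(i < n) (0 + (- (2 * beta)) * tnth x i + 0 * tnth x i ^+ 2)).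
      by apply: eq_bigr => i _; rewrite /vslope; ring.
    by rewrite sum_quadratic -/X -/Q; ring.
  by ring.
rewrite /jacobian1 pairs devE -/X.
transitivity (- (beta * (n%:R - 1) * X) +
  \sum_(i < n) ((b - a) + (- (a + b)) * tnth x i + 0 * tnth x i ^+ 2)).
  by congr (_ + _); apply: eq_bigr => i _; rewrite /vslope; ring.
by rewrite sum_quadratic -/X -/Q -mN /N; ring.
Qed.

(** The factor 2 clears the halves produced by pair symmetrization. The cross terms [x_i x_j] in the
    pair slopes are the source of [beta S^2]. *)
Lemma jacobian1_linear x : 2 * jacobian1 beta a b (- m) 1 x =
  (1 - m ^+ 2) * n%:R * (2 + beta * (n%:R - 1)) - (2 * N + 2 - beta) * sqdev x
  - 2 * m * (2 + beta * (n%:R - 1)) * dev x - beta * dev x ^+ 2.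
Proof.
set X := \sum_(i < n) tnth x i; set Q := \sum_(i < n) tnth x i ^+ 2.
have pairs : 2 * (\sum_(i < n) (\sum_(j < n | (i < j)%N)
    beta * vslope (- m) 1 (tnth x i) (tnth x j))) =
    beta * (n%:R ^+ 2 - 2 * n%:R * Q - X ^+ 2 + 2 * m * n%:R * X
      - (n%:R - 3 * Q + 2 * m * X)).
  rewrite (@sum_lt_sym R n (fun i j => beta * vslope (- m) 1 (tnth x i) (tnth x j)));
    last by move=> i j; rewrite /vslope; ring.
  have -> : \sum_(i < n) \sum_(j < n) beta * vslope (- m) 1 (tnth x i) (tnth x j) =
      beta * (n%:R ^+ 2 - 2 * n%:R * Q - X ^+ 2 + 2 * m * n%:R * X).
    transitivity (\sum_(i < n) (beta * (n%:R - Q + m * X) +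
        (beta * (n%:R * m - X)) * tnth x i + (- (beta * n%:R)) * tnth x i ^+ 2)).
      apply: eq_bigr => i _.
      transitivity (\sum_(j < n) (beta * (1 - tnth x i ^+ 2 + m * tnth x i) +
        (beta * (m - tnth x i)) * tnth x j + (- beta) * tnth x j ^+ 2)).
        by apply: eq_bigr => j _; rewrite /vslope; ring.
      by rewrite sum_quadratic -/X -/Q; ring.
    by rewrite sum_quadratic -/X -/Q; ring.
  have -> : \sum_(i < n) beta * vslope (- m) 1 (tnth x i) (tnth x i) =
      beta * (n%:R - 3 * Q + 2 * m * X).
    transitivity (\sum_(i < n) (beta + (2 * beta * m) * tnth x i +
        (- (3 * beta)) * tnth x i ^+ 2)).
      by apply: eq_bigr => i _; rewrite /vslope; ring.
    by rewrite sum_quadratic -/X -/Q; ring.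
  by ring.
rewrite /jacobian1 mulrDr pairs.
have -> : \sum_(i < n) ((a - 1) * - ((1 + tnth x i) * (- m + 1 * tnth x i)) +
    (b - 1) * ((1 - tnth x i) * (- m + 1 * tnth x i)) +
    vslope (- m) 1 (tnth x i) (tnth x i)) =
    n%:R * (1 - m * (b - a)) + (b - a + m * (a + b)) * X - (a + b + 1) * Q.
  transitivity (\sum_(i < n) ((1 - m * (b - a)) + (b - a + m * (a + b)) * tnth x i +
      (- (a + b + 1)) * tnth x i ^+ 2)).
    by apply: eq_bigr => i _; rewrite /vslope; ring.
  by rewrite sum_quadratic -/X -/Q; ring.
rewrite -mN devE sqdevE -/X -/Q /N; ring.
Qed.

End jacobi_statistics.

(** * Moment identities and bounds *)

Ltac bmf_tac := repeat first
  [ exact: bmf_cst | exact: bmf_dev | exact: bmf_sqdev | exact: bmf_carre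
  | exact: bmf_carre_sqdev | exact: bmf_carre_sqdev2
  | apply: bmf_expR | apply: bmfX | apply: bmfM | apply: bmfB | apply: bmfD ].

Section jacobi_moments.
Context (R : realType) (beta a b : R) (n : nat).
Local Notation Rn := (n.-tuple (measurableTypeR R)).
Local Notation D := (@ordered_cube R n).
Local Notation w := (@jacobi_weight R beta a b n).
Context (nu : probability Rn R) (k : R).
Hypothesis k0 : 0 < k.
Hypothesis nuE : forall A : set Rn, measurable A ->
  nu A = (k%:E * \int[tuple_lebesgue_measure R n]_(x in A) (w x)%:E)%E.

Let mD : measurable D. Proof. exact: measurable_ordered_cube. Qed.
Let nuD : nu D = 1%E. Proof. exact: (jacobi_law_cube nuE). Qed.

Variable m : R.
Let N : R := a + b + beta * (n%:R - 1).
Hypothesis mN : m * N = b - a.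
Hypothesis N0 : 0 < N.

Local Notation dev := (@dev R n m).
Local Notation sqdev := (@sqdev R n m).
Local Notation carre := (@carre R n).
Local Notation carre_sqdev := (@carre_sqdev R n m).
Local Notation carre_sqdev2 := (@carre_sqdev2 R n m).
Local Notation E := (Ex nu D).
Local Notation e t := (fun x : Rn => expR (t * sqdev x)).

Lemma vdev_const x : vdev 1 0 x = carre x.
Proof. by apply: eq_bigr => i _; rewrite /vfield; ring. Qed.

Lemma vsqdev_const x : vsqdev m 1 0 x = carre_sqdev x.
Proof. by apply: eq_bigr => i _; rewrite /vfield; ring. Qed.

Lemma vsqdev_linear x : vsqdev m (- m) 1 x = carre_sqdev2 x.
Proof. by apply: eq_bigr => i _; rewrite /vfield; ring. Qed.

Let gauss_dev s x : gauss m s 0 x = expR (s * dev x).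
Proof. by rewrite /gauss mul0r addr0. Qed.

Let gauss_sqdev t x : gauss m 0 t x = expR (t * sqdev x).
Proof. by rewrite /gauss mul0r add0r. Qed.

Lemma Ex_dev_expR s :
  N * E (fun x => dev x * expR (s * dev x)) = s * E (fun x => carre x * expR (s * dev x)).
Proof.
have H := Ex_gauss_ibp k0 nuE m 1 0 1 0 s 0.
apply/esym/eqP; rewrite -subr_eq0; apply/eqP.
rewrite -!(ExZ nu mD); [|by bmf_tac..].
rewrite -(ExB nu mD); [|by bmf_tac..].
rewrite -[RHS]H; apply: eq_Ex => x _.
by rewrite vdev_const (jacobian1_const mN) gauss_dev /N; ring.
Qed.

Lemma Ex_dev : E dev = 0.
Proof.
have := Ex_dev_expR 0; rewrite mul0r.
rewrite (@eq_Ex _ _ _ nu D _ dev) => [/eqP|x _]; last by rewrite mul0r expR0 mulr1.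
by rewrite mulf_eq0 gt_eqF//= => /eqP.
Qed.

Lemma Ex_dev_expR_sqdev t :
  N * E (fun x => dev x * e t x) = t * E (fun x => carre_sqdev x * e t x).
Proof.
have H := Ex_gauss_ibp k0 nuE m 1 0 1 0 0 t.
apply/esym/eqP; rewrite -subr_eq0; apply/eqP.
rewrite -!(ExZ nu mD); [|by bmf_tac..].
rewrite -(ExB nu mD); [|by bmf_tac..].
rewrite -[RHS]H; apply: eq_Ex => x _.
by rewrite vdev_const vsqdev_const (jacobian1_const mN) gauss_sqdev /N; ring.
Qed.

Lemma Ex_dev2_expR_sqdev t :
  N * E (fun x => dev x ^+ 2 * e t x) =
  E (fun x => carre x * e t x) + t * E (fun x => dev x * carre_sqdev x * e t x).
Proof.
have H := Ex_gauss_ibp k0 nuE m 1 0 0 1 0 t.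
apply/esym/eqP; rewrite -subr_eq0; apply/eqP.
rewrite -!(ExZ nu mD); [|by bmf_tac..].
rewrite -(ExD nu mD); [|by bmf_tac..].
rewrite -(ExB nu mD); [|by bmf_tac..].
rewrite -[RHS]H; apply: eq_Ex => x _.
by rewrite vdev_const vsqdev_const (jacobian1_const mN) gauss_sqdev /N; ring.
Qed.

Lemma Ex_sqdev_expR_sqdev t :
  (2 * N + 2 - beta) * E (fun x => sqdev x * e t x)
  + 2 * m * (2 + beta * (n%:R - 1)) * E (fun x => dev x * e t x)
  + beta * E (fun x => dev x ^+ 2 * e t x) =
  (1 - m ^+ 2) * n%:R * (2 + beta * (n%:R - 1)) * E (e t)
  + 2 * t * E (fun x => carre_sqdev2 x * e t x).
Proof.
have H := Ex_gauss_ibp k0 nuE m (- m) 1 1 0 0 t.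
apply/esym/eqP; rewrite -subr_eq0; apply/eqP.
rewrite -!(ExZ nu mD); [|by bmf_tac..].
rewrite -!(ExD nu mD); [|by bmf_tac..].
rewrite -(ExB nu mD); [|by bmf_tac..].
(* The integration by parts is doubled, since the divergence of this field is known in doubled
   form. *)
have -> : 0 = 2 * 0 :> R by rewrite mulr0.
rewrite -[in RHS]H -(ExZ nu mD); last first.
  apply: bmfM; last exact: bmf_gauss.
  apply: bmfD; first by apply: bmfM; [exact: bmf_cst|exact: bmf_vdev].
  apply: bmfM; first by bmf_tac.
  apply: bmfD; last exact: bmf_jacobian1.
  apply: bmfD; apply: bmfM; try exact: bmf_cst; [exact: bmf_vdev|exact: bmf_vsqdev].
apply: eq_Ex => x _.
have J := jacobian1_linear mN x.
rewrite -/N vsqdev_linear gauss_sqdev.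
transitivity ((2 * t * carre_sqdev2 x + 2 * jacobian1 beta a b (- m) 1 x) *
   expR (t * sqdev x)); last by ring.
by rewrite J /N; ring.
Qed.

Lemma sqdev_ge0 x : 0 <= sqdev x.
Proof. by apply: sumr_ge0 => i _; exact: sqr_ge0. Qed.

Lemma carre_bound x : D x -> 0 <= carre x <= n%:R.
Proof.
move=> Dx; have s2 i : 0 <= 1 - tnth x i ^+ 2 <= 1.
  by have /andP[? ?] := ordered_cube_itv i Dx; apply/andP; split; nra.
apply/andP; split; first by apply: sumr_ge0 => i _; case/andP: (s2 i).
rewrite -[n in n%:R]card_ord -sumr_const; apply: ler_sum => i _.
by case/andP: (s2 i).
Qed.

Lemma carre_sqdev2_bound x : D x -> 0 <= carre_sqdev2 x <= 2 * sqdev x.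
Proof.
move=> Dx; have s2 i : 0 <= 1 - tnth x i ^+ 2 <= 1.
  by have /andP[? ?] := ordered_cube_itv i Dx; apply/andP; split; nra.
apply/andP; split.
  apply: sumr_ge0 => i _; have /andP[? _] := s2 i.
  by rewrite mulr_ge0// mulr_ge0// sqr_ge0.
rewrite mulr_sumr; apply: ler_sum => i _; have /andP[_ ?] := s2 i.
by rewrite ler_piMr// mulr_ge0// sqr_ge0.
Qed.

(** The parameter [r] is kept free; it is later set to [N / n], which balances the two terms. *)
Lemma carre_sqdev_bound r x : 0 < r -> D x ->
  `|carre_sqdev x| <= r * sqdev x + n%:R / r.
Proof.
move=> r0 Dx.
have -> : r * sqdev x + n%:R / r =
    \sum_(i < n) (r * (tnth x i - m) ^+ 2 + r^-1).
  rewrite big_split/= -mulr_sumr sumr_const card_ord.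
  by rewrite -[in RHS]mulr_natl.
rewrite (le_trans (ler_norm_sum _ _ _))//; apply: ler_sum => i _.
have /andP[? ?] := ordered_cube_itv i Dx.
have s2 : `|1 - tnth x i ^+ 2| <= 1.
  by rewrite ler_norml; apply/andP; split; nra.
(* AM-GM: [2 |y| <= r y^2 + 1 / r] *)
set y := tnth x i - m.
rewrite normrM (@le_trans _ _ (`|2 * y| * 1))//; first by rewrite ler_wpM2l.
rewrite mulr1 ler_norml; apply/andP; split.
  have : 0 <= r * (y + r^-1) ^+ 2 by rewrite mulr_ge0 ?sqr_ge0// ltW.
  rewrite (_ : r * _ = r * y ^+ 2 + 2 * y + r^-1); first lra.
  by field; rewrite gt_eqF.
have : 0 <= r * (y - r^-1) ^+ 2 by rewrite mulr_ge0 ?sqr_ge0// ltW.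
rewrite (_ : r * _ = r * y ^+ 2 - 2 * y + r^-1); first lra.
by field; rewrite gt_eqF.
Qed.

(** Expanding the product as a double sum, each term is at most [2 |y_i y_j| <= y_i^2 + y_j^2], with
    [y_i = x_i - m]. *)
Lemma dev_carre_sqdev_bound x : D x ->
  `|dev x * carre_sqdev x| <= 2 * n%:R * sqdev x.
Proof.
move=> Dx.
have -> : 2 * n%:R * sqdev x =
    \sum_(i < n) \sum_(j < n) ((tnth x i - m) ^+ 2 + (tnth x j - m) ^+ 2).
  under eq_bigr do rewrite big_split/= sumr_const card_ord -mulr_natl.
  rewrite big_split/= -mulr_sumr sumr_const card_ord -mulr_natl -/(sqdev x).
  by ring.
rewrite mulr_suml (le_trans (ler_norm_sum _ _ _))//; apply: ler_sum => i _.
rewrite mulr_sumr (le_trans (ler_norm_sum _ _ _))//; apply: ler_sum => j _.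
have /andP[? ?] := ordered_cube_itv j Dx.
have s2 : `|1 - tnth x j ^+ 2| <= 1.
  by rewrite ler_norml; apply/andP; split; nra.
set y := tnth x i - m; set z := tnth x j - m.
rewrite mulrA normrM (@le_trans _ _ (`|y * (2 * z)| * 1))//.
  by rewrite ler_wpM2l.
rewrite mulr1 ler_norml; apply/andP; split.
  by have := sqr_ge0 (y + z); rewrite sqrrD; lra.
by have := sqr_ge0 (y - z); rewrite sqrrB; lra.
Qed.

End jacobi_moments.

(** * Constants of the second tail *)

Section deviation_constants.
Context (R : realType) (beta : R).

(** Bounds [n / N]: when [N >= 1], [n = 1 + (n - 1) <= N + N / beta]. *)
Definition ratio_bound : R := 1 + beta^-1.
(** Bounds [(2 + beta (n - 1)) / n] for [n >= 1]. *)
Definition drift_const : R := 2 + beta.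
(** Coefficient of [|t| E(W e)]: 4 from [Gamma(W, W)], the rest from the drift term containing
    [S]. *)
Definition carre_const : R := 2 * drift_const + 4.
(** Its three terms come from replacing [E(W e)] by its bound of order [n^2 / N], from the constant
    part of the drift, and from [E(S^2 e)] in the lower tail. *)
Definition quad_const : R := carre_const * drift_const +
  2 * drift_const * ratio_bound + 2 * beta * ratio_bound * drift_const.

End deviation_constants.

(* Here [nn = n], [x = n / N], [K = 2 N + 2 - beta], [B = 2 + beta (n - 1)],
   [F = E e], [w1 = E(W e)], [s1 = E(S e)], [s2 = E(S^2 e)], [g1 = E(Gamma(S, W) e)]
   and [g2 = E(Gamma(W, W) e) / 2], where [e = exp (t W)]. *)
Section centered_moment_bounds.
Context (R : realType) (beta N x m K B nn EW ES2 t F w1 s1 s2 g1 g2 : R).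
Local Notation b1 := (drift_const beta).
Local Notation kap := (ratio_bound beta).
Local Notation c1 := (carre_const beta).
Local Notation c3 := (quad_const beta).
Hypothesis beta0 : 0 < beta.
Hypothesis N0 : 0 < N.
Hypothesis x0 : 0 < x.
Hypothesis xkap : x <= kap.
Hypothesis nnE : nn = x * N.
Hypothesis m1 : `|m| <= 1.
Hypothesis NK : N <= K.
Hypothesis B0 : 0 <= B.
Hypothesis Bb1 : B <= b1 * nn.
Hypothesis hW : K * w1 + 2 * m * B * s1 + beta * s2 =
  (1 - m ^+ 2) * nn * B * F + 2 * t * g2.
Hypothesis hW0 : K * EW + beta * ES2 = (1 - m ^+ 2) * nn * B.
Hypothesis hS1 : N * s1 = t * g1.
Hypothesis hg1 : `|g1| <= x^-1 * w1 + nn / x^-1 * F.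
Hypothesis hS2 : N * s2 <= nn * F + `|t| * (2 * nn * w1).
Hypothesis hES2 : N * ES2 <= nn.
Hypothesis ES20 : 0 <= ES2.
Hypothesis s20 : 0 <= s2.
Hypothesis g20 : 0 <= g2.
Hypothesis g2w : g2 <= 2 * w1.
Hypothesis w10 : 0 <= w1.
Hypothesis F0 : 0 <= F.
Hypothesis EW0 : 0 <= EW.

Let b10 : 0 < b1. Proof. by rewrite /drift_const addr_gt0. Qed.

Let nn0 : 0 < nn. Proof. by rewrite nnE mulr_gt0. Qed.

Let s2_le : s2 <= x * F + 2 * x * (`|t| * w1).
Proof. by rewrite -(ler_pM2l N0) (le_trans hS2)// nnE; lra. Qed.

Let ES2_le : ES2 <= x.
Proof. by rewrite -(ler_pM2l N0) (le_trans hES2)// nnE; lra. Qed.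

(** At [t = 0], dropping [beta ES2 >= 0] leaves [N EW <= K EW <= nn B <= b1 nn^2]; note that
    [N x^2 = n^2 / N]. *)
Let EW_le : EW <= b1 * (N * x ^+ 2).
Proof.
rewrite -(ler_pM2l N0).
have H1 : N * EW <= K * EW by rewrite ler_wpM2r.
have H2 : (1 - m ^+ 2) * nn * B <= nn * B.
  rewrite ler_wpM2r// ler_piMl//; first exact: ltW.
  by have := sqr_ge0 m; lra.
have H3 : nn * B <= nn * (b1 * nn) by rewrite ler_wpM2l// ltW.
have H4 : 0 <= beta * ES2 by rewrite mulr_ge0// ltW.
have -> : N * (b1 * (N * x ^+ 2)) = nn * (b1 * nn) by rewrite nnE; ring.
by move: hW0; lra.
Qed.

(** [B] is of order [n] and [s1] carries [1 / N], so a factor [x = n / N] stands before [g1]; the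
    weight [x^-1] in the bound on [g1] cancels it in front of [w1]. *)
Let drift_le : `|2 * m * B * s1| <= 2 * b1 * `|t| * (w1 + kap * (N * x ^+ 2) * F).
Proof.
have H1 : N * `|s1| = `|t| * `|g1|.
  by rewrite -normrM -hS1 normrM (gtr0_norm N0).
have mB : `|m| * B <= 1 * (b1 * nn) by rewrite ler_pM.
have H2 : `|2 * m * B * s1| <= 2 * (b1 * nn) * `|s1|.
  by rewrite !normrM ler_wpM2r// (ger0_norm B0) (ger0_norm (ler0n _ 2)); lra.
have H3 : `|t| * `|g1| <= `|t| * (x^-1 * w1 + nn / x^-1 * F) by rewrite ler_wpM2l.
have H4 : 2 * (b1 * nn) * `|s1| = 2 * b1 * x * (`|t| * `|g1|).
  by rewrite -H1 nnE; ring.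
have H5 : 2 * b1 * x * (`|t| * `|g1|) <=
    2 * b1 * x * (`|t| * (x^-1 * w1 + nn / x^-1 * F)).
  by rewrite ler_wpM2l// !mulr_ge0// ltW.
have H6 : 2 * b1 * x * (`|t| * (x^-1 * w1 + nn / x^-1 * F)) =
    2 * b1 * `|t| * (w1 + x * (N * x ^+ 2) * F).
  by rewrite nnE; field; rewrite gt_eqF.
rewrite (le_trans H2)// H4 (le_trans H5)// H6.
rewrite ler_wpM2l//; first by rewrite !mulr_ge0// ltW.
by rewrite lerD2l ler_wpM2r// ler_wpM2r// mulr_ge0 ?sqr_ge0// ltW.
Qed.

Let Ed_le : EW * F <= b1 * (N * x ^+ 2) * F.
Proof. by rewrite ler_wpM2r. Qed.

Let half_step (A Dd : R) : 0 <= A -> N / 2 * Dd <= A -> Dd <= 2 * A / N.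
Proof. by move=> A0 H; rewrite ler_pdivlMr//; lra. Qed.

(** Subtracting [F] times the identity at [t = 0] from the one at [t] removes the constant. With
    [w1 = Dd + EW F], the part [c1 t Dd] is at most [N / 2 Dd] and is absorbed on the left;
    [- beta s2] is dropped by sign. *)
Lemma centered_moment_upper : 0 <= t -> t * c1 <= N / 2 ->
  w1 - EW * F <= (2 * beta * x / N + 2 * c3 * x ^+ 2 * t) * F.
Proof.
move=> t0 tc1; set Dd := w1 - EW * F; set nu := N * x ^+ 2.
have nu0 : 0 <= nu by rewrite mulr_ge0 ?sqr_ge0// ltW.
have kap0 : 0 < kap by rewrite (lt_le_trans x0).
have tn : `|t| = t by rewrite ger0_norm.
have c10 : 0 <= c1 by rewrite /carre_const addr_ge0// mulr_ge0// ltW.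
have c30 : 0 <= c3 by rewrite /quad_const !addr_ge0// ?mulr_ge0// ltW.
have rhs0 : 0 <= (2 * beta * x / N + 2 * c3 * x ^+ 2 * t) * F.
  rewrite mulr_ge0// addr_ge0// ?mulr_ge0 ?sqr_ge0 ?invr_ge0// ltW//.
(* Positivity of [Dd] is what allows [K] to be lowered to [N] and [t c1] to be raised to [N / 2]. *)
have [Dd0|Dd0] := leP Dd 0; first exact: le_trans Dd0 rhs0.
have K1 : K * Dd <= c1 * t * w1 + 2 * b1 * kap * t * nu * F + beta * x * F.
  have E1 : K * Dd = 2 * t * g2 - 2 * m * B * s1 - beta * s2 + beta * ES2 * F.
    have : K * EW * F + beta * ES2 * F = (1 - m ^+ 2) * nn * B * F.
      by rewrite -mulrDl hW0.
    by move: hW; rewrite /Dd; lra.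
  have E2 : t * g2 <= t * (2 * w1) by rewrite ler_wpM2l.
  have E3 : 0 <= beta * s2 by rewrite mulr_ge0// ltW.
  have E4 : beta * ES2 * F <= beta * x * F by rewrite ler_wpM2r// ler_wpM2l// ltW.
  have := drift_le; rewrite tn ler_norml => /andP[E5 _].
  by rewrite E1 /carre_const; rewrite -/nu in E5; lra.
have K2 : N * Dd <= K * Dd by rewrite ler_wpM2r// ltW.
have K3 : t * c1 * Dd <= N / 2 * Dd by rewrite ler_wpM2r// ltW.
have K4 : c1 * t * (EW * F) <= c1 * t * (b1 * nu * F).
  by rewrite ler_wpM2l// mulr_ge0.
have K5 : 0 <= 2 * beta * kap * b1 * t * nu * F.
  by rewrite !mulr_ge0// ltW.
have -> : (2 * beta * x / N + 2 * c3 * x ^+ 2 * t) * F =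
    2 * ((beta * x + c3 * t * nu) * F) / N.
  by rewrite /nu; field; rewrite gt_eqF.
apply: half_step.
  by rewrite mulr_ge0// addr_ge0// !mulr_ge0// ltW.
by move: K1 K2 K3 K4 K5; rewrite /quad_const /Dd; lra.
Qed.

(** Here [w1 <= EW F] bounds the self-bounding term at once, in place of absorption. The signs of
    the [S^2] terms are exchanged: [beta ES2 F] is dropped and [beta s2] has to be estimated. *)
Lemma centered_moment_lower : t <= 0 -> w1 <= EW * F ->
  EW * F - w1 <= (2 * beta * x / N + 2 * c3 * x ^+ 2 * - t) * F.
Proof.
move=> t0 wEW; set Dd := EW * F - w1; set nu := N * x ^+ 2.
have nu0 : 0 <= nu by rewrite mulr_ge0 ?sqr_ge0// ltW.
have kap0 : 0 < kap by rewrite (lt_le_trans x0).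
pose r := - t; have r0 : 0 <= r by rewrite /r; lra.
have tn : `|t| = r by rewrite ler0_norm.
have tE : t = - r by rewrite /r opprK.
have c10 : 0 <= c1 by rewrite /carre_const addr_ge0// mulr_ge0// ltW.
have c30 : 0 <= c3 by rewrite /quad_const !addr_ge0// ?mulr_ge0// ltW.
have Dd0 : 0 <= Dd by rewrite subr_ge0.
have wb : w1 <= b1 * nu * F by rewrite (le_trans wEW).
have K1 : K * Dd <= c1 * r * w1 + 2 * b1 * kap * r * nu * F + beta * x * F
    + 2 * beta * x * (r * w1).
  have E1 : K * Dd = 2 * r * g2 + 2 * m * B * s1 + beta * s2 - beta * ES2 * F.
    have : K * EW * F + beta * ES2 * F = (1 - m ^+ 2) * nn * B * F.
      by rewrite -mulrDl hW0.
    by move: hW; rewrite /Dd tE; lra.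
  have E2 : r * g2 <= r * (2 * w1) by rewrite ler_wpM2l.
  have E3 : 0 <= beta * ES2 * F by rewrite !mulr_ge0// ltW.
  have E4 : beta * s2 <= beta * (x * F + 2 * x * (r * w1)).
    by rewrite -tn ler_wpM2l// ltW.
  have := drift_le; rewrite tn ler_norml => /andP[_ E5].
  by rewrite E1 /carre_const; rewrite -/nu in E5; lra.
have K2 : N * Dd <= K * Dd by rewrite ler_wpM2r.
have K3 : c1 * r * w1 <= c1 * r * (b1 * nu * F) by rewrite ler_wpM2l// mulr_ge0.
have K4 : x * (r * w1) <= kap * (r * (b1 * nu * F)).
  by rewrite ler_pM// ?mulr_ge0// ?ler_wpM2l// ltW.
have K5 : beta * (x * (r * w1)) <= beta * (kap * (r * (b1 * nu * F))).
  by rewrite ler_wpM2l// ltW.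
have -> : (2 * beta * x / N + 2 * c3 * x ^+ 2 * - t) * F =
    2 * ((beta * x + c3 * r * nu) * F) / N.
  by rewrite /nu /r; field; rewrite gt_eqF.
apply: half_step.
  by rewrite mulr_ge0// addr_ge0// !mulr_ge0// ltW.
have ND : 0 <= N * Dd by rewrite mulr_ge0// ltW.
by move: K1 K2 K3 K5 ND; rewrite /quad_const; lra.
Qed.

End centered_moment_bounds.

(** * Concentration *)

Section jacobi_concentration.
Context (R : realType) (beta a b : R) (n : nat).
Local Notation Rn := (n.-tuple (measurableTypeR R)).
Local Notation D := (@ordered_cube R n).
Local Notation w := (@jacobi_weight R beta a b n).
Context (nu : probability Rn R) (k : R).
Hypothesis k0 : 0 < k.
Hypothesis nuE : forall A : set Rn, measurable A ->
  nu A = (k%:E * \int[tuple_lebesgue_measure R n]_(x in A) (w x)%:E)%E.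

Let mD : measurable D. Proof. exact: measurable_ordered_cube. Qed.
Let nuD : nu D = 1%E. Proof. exact: (jacobi_law_cube nuE). Qed.

Variable m : R.
Let N : R := a + b + beta * (n%:R - 1).
Hypothesis mN : m * N = b - a.
Hypotheses (beta0 : 0 < beta) (a0 : 0 < a) (b0 : 0 < b) (n0 : (0 < n)%N).
Hypothesis N0 : Num.max 1 beta <= N.

Local Notation dev := (@dev R n m).
Local Notation sqdev := (@sqdev R n m).
Local Notation E := (Ex nu D).
Local Notation e t := (fun x : Rn => expR (t * sqdev x)).

Let N1 : 1 <= N. Proof. by move: N0; rewrite ge_max => /andP[]. Qed.

Let Nbeta : beta <= N. Proof. by move: N0; rewrite ge_max => /andP[]. Qed.

Let Ngt0 : 0 < N. Proof. exact: lt_le_trans N1. Qed.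

Let n1 : (1 : R) <= n%:R. Proof. by rewrite ler1n. Qed.

Let ngt0 : (0 : R) < n%:R. Proof. exact: lt_le_trans n1. Qed.

Let m_le1 : `|m| <= 1.
Proof.
rewrite -(ler_pM2r Ngt0) mul1r -{1}(gtr0_norm Ngt0) -normrM mN.
have bn : 0 <= beta * (n%:R - 1) by rewrite mulr_ge0 ?subr_ge0// ltW.
move: a0 b0 bn; rewrite ler_norml /N => *; apply/andP; split; lra.
Qed.

Lemma size_le_ratio_bound : n%:R / N <= ratio_bound beta.
Proof.
rewrite ler_pdivrMr// /ratio_bound mulrDl mul1r -lerBlDl.
apply: (@le_trans _ _ (n%:R - 1)); first by move: N1; lra.
rewrite -(ler_pM2l beta0) mulrA divff ?gt_eqF// mul1r /N.
by move: a0 b0; lra.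
Qed.

(** The sign [sg] treats both tails together, since the eigenfunction identity brings it in only
    through [sg ^+ 2]. *)
Lemma dev_tail (sg u : R) : sg ^+ 2 = 1 -> 0 < u ->
  (nu [set x | (u < sg * dev x)%R] <= (expR (- (N * u ^+ 2 / (2 * n%:R))))%:E)%E.
Proof.
move=> sg2 u0.
have bU : bmf D (fun x => sg * dev x) by bmf_tac.
(* The minimizer of the exponent [n t^2 / (2 N) - t u]. *)
have t0 : 0 <= N * u / n%:R by rewrite !mulr_ge0 ?invr_ge0// ltW.
have H s : 0 <= s <= N * u / n%:R ->
    E (fun x => sg * dev x * expR (s * (sg * dev x))) <=
    (0 + 2 * (n%:R / (2 * N)) * s) * mgf nu D (fun x => sg * dev x) s.
  move=> /andP[s0 _]; rewrite add0r /mgf.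
  have mulE x : s * (sg * dev x) = (s * sg) * dev x by ring.
  rewrite (@eq_Ex _ _ _ nu D _ (fun x => sg * (dev x * expR ((s * sg) * dev x)))); last first.
    by move=> x _; rewrite mulE mulrA.
  rewrite [X in _ <= _ * X](@eq_Ex _ _ _ nu D _ (fun x => expR ((s * sg) * dev x))); last first.
    by move=> x _; rewrite mulE.
  rewrite (ExZ nu mD); last by bmf_tac.
  rewrite -(ler_pM2l Ngt0) mulrCA (Ex_dev_expR k0 nuE mN (s * sg)).
  rewrite (_ : sg * _ = s * E (fun x => carre x * expR ((s * sg) * dev x))); last first.
    by rewrite mulrA [sg * _]mulrCA -expr2 sg2 mulr1.
  rewrite (_ : N * _ = s * (n%:R * E (fun x => expR ((s * sg) * dev x)))); last first.
    by field; rewrite gt_eqF.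
  rewrite ler_wpM2l// -(ExZ nu mD); last by bmf_tac.
  apply: (le_Ex nu mD); [by bmf_tac..|move=> x Dx].
  by rewrite ler_wpM2r ?expR_ge0//; case/andP: (carre_bound Dx).
rewrite (le_trans (chernoff_mgf mD nuD u bU t0 H))// lee_fin ler_expR.
rewrite le_eqVlt; apply/orP; left; apply/eqP.
by field; rewrite !gt_eqF.
Qed.

Local Notation x := (n%:R / N).

Let x0 : 0 < x. Proof. exact: divr_gt0. Qed.

Let e0E (f : Rn -> R) : E (fun y => f y * expR (0 * sqdev y)) = E f.
Proof. by apply: eq_Ex => y _; rewrite mul0r expR0 mulr1. Qed.

Let e0E1 : E (e 0) = 1.
Proof.
rewrite -[RHS](Ex_cst mD nuD); apply: eq_Ex => y _.
by rewrite mul0r expR0.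
Qed.

(** The input to the centred bounds for either sign of [t], with the AM-GM parameter set to
    [x^-1 = N / n]; the case [t = 0] also yields the second moment of [S]. *)
Let moments t :
  [/\ [/\ (2 * N + 2 - beta) * E (fun x => sqdev x * e t x)
       + 2 * m * (2 + beta * (n%:R - 1)) * E (fun x => dev x * e t x)
       + beta * E (fun x => dev x ^+ 2 * e t x) =
       (1 - m ^+ 2) * n%:R * (2 + beta * (n%:R - 1)) * E (e t) +
         2 * t * E (fun x => carre_sqdev2 m x * e t x),
      N * E (fun x => dev x * e t x) = t * E (fun x => carre_sqdev m x * e t x) &
      N * E (fun x => dev x ^+ 2 * e t x) <= n%:R * E (e t) +
        `|t| * (2 * n%:R * E (fun x => sqdev x * e t x))],
   `|E (fun x => carre_sqdev m x * e t x)| <=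
     x^-1 * E (fun x => sqdev x * e t x) + n%:R / x^-1 * E (e t),
   0 <= E (fun x => dev x ^+ 2 * e t x),
   0 <= E (fun x => carre_sqdev2 m x * e t x) <= 2 * E (fun x => sqdev x * e t x) &
   0 <= E (fun x => sqdev x * e t x) /\ 0 <= E (e t)].
Proof.
split.
- split; [exact: (Ex_sqdev_expR_sqdev k0 nuE mN t)|
    exact: (Ex_dev_expR_sqdev k0 nuE mN t)|].
  rewrite [leLHS](Ex_dev2_expR_sqdev k0 nuE mN t); apply: lerD.
    rewrite -(ExZ nu mD); last by bmf_tac.
    apply: (le_Ex nu mD); [by bmf_tac..|move=> y Dy].
    by rewrite ler_wpM2r ?expR_ge0//; case/andP: (carre_bound Dy).
  rewrite (le_trans (ler_norm _))// normrM ler_wpM2l//.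
  rewrite -(ExZ nu mD); last by bmf_tac.
  have bl : bmf D (fun x => dev x * carre_sqdev m x * e t x) by bmf_tac.
  have br : bmf D (fun x => 2 * n%:R * (sqdev x * e t x)) by bmf_tac.
  rewrite ler_norml -mulN1r -(ExZ nu mD)//.
  have bd y : D y -> - (2 * n%:R * sqdev y) <= dev y * carre_sqdev m y <=
      2 * n%:R * sqdev y.
    by move=> Dy; rewrite -ler_norml dev_carre_sqdev_bound.
  apply/andP; split; apply: (le_Ex nu mD) => [||y /bd/andP[lo hi]];
    try by bmf_tac.
    by rewrite mulN1r mulrA -mulNr ler_wpM2r ?expR_ge0.
  by rewrite mulrA ler_wpM2r ?expR_ge0.
- rewrite -!(ExZ nu mD); [|by bmf_tac..].
  rewrite -(ExD nu mD); [|by bmf_tac..].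
  have xV : 0 < x^-1 by rewrite invr_gt0.
  rewrite ler_norml -mulN1r -(ExZ nu mD); last by bmf_tac.
  have bd y : D y -> - (x^-1 * sqdev y + n%:R / x^-1) <= carre_sqdev m y <=
      x^-1 * sqdev y + n%:R / x^-1.
    by move=> Dy; rewrite -ler_norml carre_sqdev_bound.
  apply/andP; split; apply: (le_Ex nu mD) => [||y /bd/andP[lo hi]];
    try by bmf_tac.
    by rewrite mulN1r mulrA -mulrDl -mulNr ler_wpM2r ?expR_ge0.
  by rewrite mulrA -mulrDl ler_wpM2r ?expR_ge0.
- by apply: Ex_ge0 => y _; rewrite mulr_ge0 ?sqr_ge0 ?expR_ge0.
- apply/andP; split.
    apply: Ex_ge0 => y Dy; rewrite mulr_ge0 ?expR_ge0//.
    by case/andP: (carre_sqdev2_bound m Dy).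
  rewrite -(ExZ nu mD); last by bmf_tac.
  apply: (le_Ex nu mD); [by bmf_tac..|move=> y Dy].
  rewrite mulrA ler_wpM2r ?expR_ge0//.
  by case/andP: (carre_sqdev2_bound m Dy).
- split; first by apply: Ex_ge0 => y _; rewrite mulr_ge0 ?sqdev_ge0 ?expR_ge0.
  by apply: Ex_ge0 => y _; exact: expR_ge0.
Qed.

Let EW := E sqdev.

Let EW0 : 0 <= EW. Proof. by apply: Ex_ge0 => y _; exact: sqdev_ge0. Qed.

Let nE : (n%:R : R) = x * N. Proof. by rewrite mulfVK ?gt_eqF. Qed.

Let NK : N <= 2 * N + 2 - beta. Proof. by move: N1 Nbeta; lra. Qed.

Let B0 : 0 <= 2 + beta * (n%:R - 1).
Proof. by rewrite addr_ge0// mulr_ge0 ?subr_ge0// ltW. Qed.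

Let Ble : 2 + beta * (n%:R - 1) <= drift_const beta * n%:R.
Proof. by rewrite /drift_const; move: n1 beta0; lra. Qed.

(* Negative correlation of the increasing [W] and the decreasing [exp (t W)]. *)
Let sqdev_le_corr t : t <= 0 -> E (fun x => sqdev x * e t x) <= EW * E (e t).
Proof.
move=> t0; rewrite -subr_le0 -(ExZ nu mD); last by bmf_tac.
rewrite -(ExB nu mD); [|by bmf_tac..].
have cov : E (fun y => (sqdev y - EW) * expR (t * EW)) = 0.
  transitivity (expR (t * EW) * E (fun y => sqdev y - EW)).
    by rewrite -(ExZ nu mD); [apply: eq_Ex => y _; rewrite mulrC|bmf_tac].
  rewrite (ExB nu mD); [|by bmf_tac..].
  by rewrite (Ex_cst mD nuD) subrr mulr0.
rewrite -[leRHS]cov; apply: (le_Ex nu mD); [by bmf_tac..|move=> y _].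
rewrite -mulrBl; have [le|/ltW le] := leP EW (sqdev y).
  by rewrite ler_wpM2l ?subr_ge0// ler_expR ler_wnM2l.
by rewrite ler_wnM2l ?subr_le0// ler_expR ler_wnM2l.
Qed.

Let hW0 : (2 * N + 2 - beta) * EW + beta * E (fun y => dev y ^+ 2) =
  (1 - m ^+ 2) * n%:R * (2 + beta * (n%:R - 1)).
Proof.
have := Ex_sqdev_expR_sqdev k0 nuE mN 0.
rewrite !e0E e0E1 (Ex_dev k0 nuE mN Ngt0) !(mulr0, mul0r) !addr0 mulr1.
by [].
Qed.

Let hES2 : N * E (fun y => dev y ^+ 2) <= n%:R.
Proof.
have [[_ _ +] _ _ _ _] := moments 0.
by rewrite !e0E e0E1 normr0 mul0r addr0 mulr1.
Qed.

Let ES20 : 0 <= E (fun y => dev y ^+ 2).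
Proof. by apply: Ex_ge0 => y _; exact: sqr_ge0. Qed.

Lemma sqdev_tail (sg u t : R) : sg ^+ 2 = 1 -> 0 <= t ->
  t * carre_const beta <= N / 2 ->
  (nu [set y | (u < sg * (sqdev y - E sqdev))%R] <=
   (expR (2 * beta * x / N * t + quad_const beta * x ^+ 2 * t ^+ 2 - t * u))%:E)%E.
Proof.
move=> sg2 t0 tc; rewrite -/EW.
have bU : bmf D (fun y => sg * (sqdev y - EW)) by bmf_tac.
apply: (chernoff_mgf mD nuD u bU t0) => s /andP[s0 st].
(* Centring puts the factor [expR (- (s * sg * EW))] on both sides. Once it is cancelled, the claim
   is a bound on [sg] times [E(W e) - EW E(e)] at parameter [s * sg]. *)
have mulE y : s * (sg * (sqdev y - EW)) = - (s * sg * EW) + s * sg * sqdev y by ring.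
rewrite /mgf.
rewrite (@eq_Ex _ _ _ nu D _ (fun y => expR (- (s * sg * EW)) *
    (sg * (sqdev y * e (s * sg) y - EW * e (s * sg) y)))); last first.
  by move=> y _; rewrite mulE expRD; ring.
rewrite [X in _ <= _ * X](@eq_Ex _ _ _ nu D _ (fun y =>
    expR (- (s * sg * EW)) * e (s * sg) y)); last first.
  by move=> y _; rewrite mulE expRD.
rewrite 2?(ExZ nu mD); [|by bmf_tac..].
rewrite [X in _ <= _ * X](ExZ nu mD); last by bmf_tac.
rewrite (ExB nu mD); [|by bmf_tac..].
rewrite [X in _ * (_ * (_ - X))](ExZ nu mD); last by bmf_tac.
rewrite [leRHS]mulrCA ler_wpM2l ?expR_ge0//.
rewrite [2 * (_ * x ^+ 2)]mulrA.
have [[hW hS1 hS2] hg1 hs2 /andP[hg20 hg2] [hw1 hF]] := moments (s * sg).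
have [sgE|sgE] : sg = 1 \/ sg = -1.
  by move/eqP: sg2; rewrite sqrf_eq1 => /orP[]/eqP; [left|right].
- have tE : s * sg = s by rewrite sgE mulr1.
  rewrite tE in hW hS1 hS2 hg1 hs2 hg20 hg2 hw1 hF *.
  have tc' : s * carre_const beta <= N / 2.
    rewrite (le_trans _ tc)// ler_wpM2r//.
    by rewrite /carre_const /drift_const; move: beta0; lra.
  by rewrite sgE mul1r; exact: (centered_moment_upper beta0 Ngt0 x0
    size_le_ratio_bound nE m_le1 NK B0 Ble hW hW0 hS1 hg1 hES2 ES20 hs2 hg2 hF
    EW0 s0 tc').
- have tE : s * sg = - s by rewrite sgE mulrN1.
  rewrite tE in hW hS1 hS2 hg1 hs2 hg20 hg2 hw1 hF *.
  have s0' : - s <= 0 by rewrite oppr_le0.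
  rewrite sgE mulN1r opprB -[X in _ <= (_ + _ * X) * _]opprK.
  exact: (centered_moment_lower beta0 Ngt0 x0 size_le_ratio_bound nE m_le1 NK B0
    Ble hW hW0 hS1 hg1 hS2 ES20 hg2 hw1 hF EW0 s0' (sqdev_le_corr s0')).
Qed.

End jacobi_concentration.

(** * Transfer from the law to the random vector *)

Section random_vector.
Context d d' (T : measurableType d) (T' : measurableType d') (R : realType).
Context (P : probability T R) (X : {RV P >-> T'}) (D : set T').
Hypothesis mD : measurable D.
Hypothesis PD : distribution P X D = 1%E.

(** As [f] is bounded only on [D], the integral is first restricted to the preimage of [D], an event
    of probability 1, and pushed forward from there. *)
Lemma expectation_Ex (f : T' -> R) : bmf D f ->
  ('E_P[f \o X] = (Ex (distribution P X) D f)%:E)%E.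
Proof.
move=> bf; have [mf [M fM]] := bf.
have mX : measurable_fun setT X := measurable_funP X.
have mXD : measurable (X @^-1` D) by rewrite -[X in measurable X]setTI; exact: mX.
have PXD : P (X @^-1` D) = 1%E by exact: PD.
have mfX : measurable_fun setT (f \o X) by exact: measurableT_comp.
have bfX : bmf (X @^-1` D) (f \o X) by split => //; exists M => w /fM.
have ifX := bmf_integrable P mXD bfX.
rewrite unlock; transitivity (\int[P]_(w in X @^-1` D) (f (X w))%:E)%E.
  rewrite [RHS]integral_mkcond; apply: ae_eq_integral => //.
  - exact/measurable_EFinP.
  - by apply/(measurable_restrictT _ mXD)/measurable_EFinP; exact: measurable_funTS.
  - exists (~` (X @^-1` D)); split; first exact: measurableC.
      by rewrite [LHS](probability_setC P mXD) PXD subee.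
    move=> w /= H Dw; apply: H => _; rewrite patchE mem_set//.
rewrite /Ex /Rintegral fineK.
  by rewrite (integral_pushforward mX _ ifX mD)//; exact/measurable_EFinP.
by apply: integrable_fin_num => //; exact: bmf_integrable.
Qed.

Lemma two_sided_tail (f : T' -> R) (u : R) : measurable_fun setT f ->
  (P [set w | (u < `|f (X w)|)%R] <=
   distribution P X [set x | (u < 1 * f x)%R] +
   distribution P X [set x | (u < -1 * f x)%R])%E.
Proof.
move=> mf.
have mc (c : R) : measurable [set x | (u < c * f x)%R].
  by apply: measurable_set_pred; apply: measurable_fun_ltr => //; exact: measurable_funM.
have mX : measurable_fun setT X := measurable_funP X.
rewrite -[X in (X <= _)%E]/(distribution P X [set x | (u < `|f x|)%R]).
rewrite (le_trans _ (measureU2 _ (mc 1) (mc (-1))))//.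
apply: le_measure; rewrite ?inE.
- apply: measurable_set_pred; apply: measurable_fun_ltr => //.
  exact: measurableT_comp.
- exact: measurableU.
- by move=> x /=; rewrite ltr_normr mul1r mulN1r => /orP.
Qed.

End random_vector.

Theorem theorem6 (R : realType) (beta c0 : R) (hbeta : 0 < beta) (hc0 : 0 < c0) :
  exists C c N0 : R, [/\ 0 < C, 0 < c & 0 < N0] /\
    forall (n : nat) (a b : R), (1 <= n)%N -> 0 < a -> 0 < b -> c0 <= a + b ->
    let N := a + b + beta * (n%:R - 1) in
    N0 <= N ->
    forall (d : measure_display) (T : measurableType d) (P : probability T R)
      (mu : {RV P >-> n.-tuple (measurableTypeR R)}),
    jacobi_ensemble beta a b mu ->
    let M1 := empirical_mean mu in
    let M2 := empirical_variance mu in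
    forall eps : R, 0 < eps ->
      (P [set w | (`|M1 w - fine 'E_P[M1]| > eps)%R]
         <= (C * expR (- (c * N * n%:R * eps ^+ 2)))%:E)%E /\
      (P [set w | (`|M2 w - fine 'E_P[M2]| > eps)%R]
         <= (C * expR (- (c * N * eps * Num.min (N * eps) n%:R)))%:E)%E.
Proof.
have kap0 : 0 < ratio_bound beta by rewrite addr_gt0 ?invr_gt0.
have b10 : 2 < drift_const beta by rewrite /drift_const; lra.
have c10 : 8 < carre_const beta by rewrite /carre_const; lra.
have c3c1 : carre_const beta <= quad_const beta.
  have h1 : carre_const beta * 1 <= carre_const beta * drift_const beta.
    by rewrite ler_wpM2l; lra.
  have h2 : 0 <= 2 * drift_const beta * ratio_bound beta.
    by rewrite !mulr_ge0//; lra.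
  have h3 : 0 <= 2 * beta * ratio_bound beta * drift_const beta.
    by rewrite !mulr_ge0//; lra.
  by rewrite /quad_const; lra.
set q := quad_const beta; have q0 : 8 < q by exact: lt_le_trans c3c1.
(* At [t = c N mn / n] the quadratic term of the exponent is [q c^2 mn^2 = (c / 2) mn^2], at most
   half of the gain [c N eps mn]. *)
pose c := (2 * q)^-1.
have cp : 0 < c by rewrite invr_gt0; lra.
have cq : c * q = 2^-1 by rewrite /c; field; lra.
have c_small : c <= 1 / 8.
  by rewrite /c -div1r ler_pdivrMr; lra.
(* Bound on the linear term of the exponent, which equals [2 beta c mn / N] with [mn <= n]. *)
pose bias := 2 * beta * c * ratio_bound beta.
have bias0 : 0 <= bias by rewrite !mulr_ge0//; lra.
(* The 2 counts the two tails and [expR bias] absorbs the linear term. [N >= 1] enters the bound on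
   [n / N], and [N >= beta] gives [N <= K]. *)
exists (2 * expR bias), (c / 2), (Num.max 1 beta); split.
  split; first by rewrite mulr_gt0 ?expR_gt0.
    by rewrite divr_gt0.
  by rewrite lt_max ltr01.
move=> n a b n0 a0 b0 _ N NN d T P X [k k0 kE] M1 M2 eps eps0.
have N1 : 1 <= N by move: NN; rewrite ge_max => /andP[].
have Np : 0 < N by lra.
have np : (0 : R) < n%:R by rewrite ltr0n.
pose m := (b - a) / N.
have mN : m * N = b - a by rewrite mulfVK// gt_eqF.
pose D := @ordered_cube R n.
have mD : measurable D by exact: measurable_ordered_cube.
have nuD := jacobi_law_cube kE.
set nu := distribution P X in nuD.
have bdev := @bmf_dev R n m.
have bsq := @bmf_sqdev R n m.
have edev : Ex nu D (dev m) = 0 := Ex_dev k0 kE mN Np.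
have M1E : M1 = (fun x => n%:R^-1 * dev m x + m) \o X.
  apply/funext => w; rewrite /M1 /empirical_mean /= devE.
  by field; rewrite gt_eqF.
(* Since [E S = 0], the deterministic centre in [M2] is [m], and [n M2] is exactly [W]. *)
have EM1 : fine 'E_P[M1] = m.
  rewrite M1E (expectation_Ex mD nuD); last by bmf_tac.
  rewrite /= (ExD nu mD); [|by bmf_tac..].
  rewrite (ExZ nu mD)// edev mulr0 add0r.
  exact: (Ex_cst mD nuD).
have M2E : M2 = (fun x => n%:R^-1 * sqdev m x) \o X.
  apply/funext => w; rewrite /M2 /empirical_variance /=.
  by rewrite -/M1 EM1.
have EM2 : fine 'E_P[M2] = n%:R^-1 * Ex nu D (sqdev m).
  rewrite M2E (expectation_Ex mD nuD); last by bmf_tac.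
  by rewrite /= (ExZ nu mD).
have u0 : 0 < n%:R * eps by rewrite mulr_gt0.
have expb : 1 <= expR bias by rewrite -expR0 ler_expR.
have twice (y z : R) : y <= expR bias * z -> y + y <= 2 * expR bias * z.
  by move=> yz; lra.
split.
  rewrite EM1 [X in P X](_ : _ = [set w | (n%:R * eps < `|dev m (X w)|)%R]); last first.
    apply/seteqP; split => w /=; rewrite M1E /= addrK normrM gtr0_norm ?invr_gt0//;
      by rewrite ltr_pdivlMl.
  rewrite (le_trans (two_sided_tail X _ bdev.1))//.
  have s1 : (1 : R) ^+ 2 = 1 by rewrite expr1n.
  have sN1 : (-1 : R) ^+ 2 = 1 by rewrite sqrrN expr1n.
  have t1 := dev_tail k0 kE mN n0 NN s1 u0.
  have tN1 := dev_tail k0 kE mN n0 NN sN1 u0.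
  rewrite (le_trans (leeD t1 tN1))// -EFinD lee_fin; apply: twice.
  rewrite -[leLHS]mul1r ler_pM ?expR_ge0// ler_expR lerN2.
  rewrite -/N (_ : N * _ / _ = 2^-1 * (N * n%:R * eps ^+ 2)); last first.
    by field; rewrite gt_eqF.
  rewrite (_ : c / 2 * N * _ * _ = c / 2 * (N * n%:R * eps ^+ 2)); last by ring.
  rewrite ler_wpM2r//.
    by rewrite !mulr_ge0 ?sqr_ge0// ltW.
  by lra.
set mn := Num.min (N * eps) n%:R.
have mn0 : 0 < mn by rewrite lt_min mulr_gt0.
have mnN : mn <= N * eps by rewrite ge_min lexx.
have mnn : mn <= n%:R by rewrite ge_min lexx orbT.
rewrite EM2 [X in P X](_ : _ = [set w | (n%:R * eps <
    `|(fun x => sqdev m x - Ex nu D (sqdev m)) (X w)|)%R]); last first.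
  apply/seteqP; split => w /=; rewrite M2E /= -mulrBr normrM gtr0_norm ?invr_gt0//;
    by rewrite ltr_pdivlMl.
have bc : bmf D (fun x => sqdev m x - Ex nu D (sqdev m)) by bmf_tac.
rewrite (le_trans (two_sided_tail X _ bc.1))//.
(* Of order [N^2 eps / n], the optimum for the quadratic exponent, truncated by [mn <= n] to stay
   below [c N]. *)
pose t := c * N * mn / n%:R.
have t0 : 0 <= t by apply/ltW; rewrite divr_gt0 ?mulr_gt0.
have tc : t * carre_const beta <= N / 2.
  have tN : t <= c * N.
    by rewrite /t ler_pdivrMr// ler_wpM2l// mulr_ge0// ltW.
  have h1 : t * carre_const beta <= (c * N) * q by rewrite ler_pM//; lra.
  rewrite (le_trans h1)// mulrAC cq; lra.
have s1 : (1 : R) ^+ 2 = 1 by rewrite expr1n.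
have sN1 : (-1 : R) ^+ 2 = 1 by rewrite sqrrN expr1n.
have t1 := sqdev_tail k0 kE mN hbeta a0 b0 n0 NN (n%:R * eps) s1 t0 tc.
have tN1 := sqdev_tail k0 kE mN hbeta a0 b0 n0 NN (n%:R * eps) sN1 t0 tc.
rewrite (le_trans (leeD t1 tN1))// -EFinD lee_fin; apply: twice.
rewrite -expRD ler_expR -/N -/q.
have xk : n%:R / N <= ratio_bound beta := size_le_ratio_bound hbeta a0 b0 NN.
have e1 : 2 * beta * (n%:R / N) / N * t <= bias.
  have -> : 2 * beta * (n%:R / N) / N * t = 2 * beta * c * (mn / N).
    by rewrite /t; field; rewrite !gt_eqF.
  rewrite /bias ler_wpM2l; first by [].
    by rewrite !mulr_ge0// ltW.
  by rewrite (le_trans _ xk)// ler_pM2r// invr_gt0.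
have e2 : q * (n%:R / N) ^+ 2 * t ^+ 2 = c / 2 * (mn * mn).
  rewrite (_ : c / 2 = c * (c * q)); last by rewrite cq.
  by rewrite /t; field; rewrite !gt_eqF.
have e3 : c / 2 * (mn * mn) <= c / 2 * (N * eps * mn).
  by rewrite ler_wpM2l// ?ler_wpM2r// ?divr_ge0// ltW.
have e4 : t * (n%:R * eps) = c * (N * eps * mn).
  by rewrite /t; field; rewrite gt_eqF.
have -> : c / 2 * N * eps * mn = c / 2 * (N * eps * mn) by ring.
lra.
Qed.
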